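(* Let $H$ be a graph with at least one edge such that $\mathrm{hcf}_{\xi}(H) \neq 2$. For every $\gamma > 0$ there exists an integer $n_0 = n_0(\gamma, H)$ such that for every integer $n \geq n_0$, $$\left(1 - \frac{1}{\xi^*(H)}\right)n - 1 \;\leq\; \delta_{\mathrm{sub}}(n, H) \;\leq\; \left(1 - \frac{1}{\xi^*(H)} + \gamma\right)n .$$
   Context: Graphs are finite and simple. $v(H)$ and $e(H)$ denote the numbers of vertices and edges of $H$, and $H[X]$ is the subgraph induced by $X \subseteq V(H)$. A subdivision of $H$ is a graph obtained from $H$ by replacing edges of $H$ with (internally) vertex-disjoint paths (of length at least one) keeping the endpoints; $H$ itself is a subdivision of $H$. A graph $G$ has a perfect $H$-subdivision tiling if $G$ contains a collection of vertex-disjoint subgraphs, each of which is (isomorphic to) a subdivision of $H$, whose union covers all vertices of $G$. $\delta_{\mathrm{sub}}(n,H)$ is the smallest integer $k$ such that every $n$-vertex graph with minimum degree at least $k$ has a perfect $H$-subdivision tiling. For $X \subseteq V(H)$ and $Y = V(H)\setminus X$ let $f_H(X) = \frac{v(H) + e(H[X]) + e(H[Y])}{|X| + e(H[Y])}$, and let $\xi(H) = \min\{f_H(X) : X \subseteq V(H)\}$. Let $\mathcal{C}(H) = \{(|X| + e(H[Y])) - (|Y| + e(H[X])) : X \subseteq V(H),\ Y = V(H)\setminus X\}$, and let $\mathrm{hcf}_{\xi}(H)$ be the highest common factor of all integers in $\mathcal{C}(H)$ (with $\mathrm{hcf}_\xi(H) = \infty$ if $\mathcal{C}(H) = \{0\}$).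 Define $\xi^*(H) = \xi(H)$ if $\mathrm{hcf}_{\xi}(H) = 1$; $\xi^*(H) = \max\{\frac{3}{2}, \xi(H)\}$ if $\mathrm{hcf}_{\xi}(H) = 2$; and $\xi^*(H) = 2$ otherwise. *)

(* Defs.v *)
From mathcomp Require Import all_boot all_order all_algebra.
From mathcomp Require Import boolp reals.

Set Implicit Arguments.
Unset Strict Implicit.
Unset Printing Implicit Defensive.

Import Order.TTheory GRing.Theory Num.Theory.

Record sgraph := SGraph {
  vertex :> finType;
  adj : rel vertex;
  adj_sym : symmetric adj;
  adj_irrefl : irreflexive adj }.

Definition edges (G : sgraph) : {set {set G}} :=
  [set E : {set G} | [exists x, exists y, adj x y && (E == [set x; y])]].

(* The edge set of the induced subgraph G[X]. *)
Definition induced_edges (G : sgraph) (X : {set G}) : {set {set G}} :=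
  [set E in edges G | E \subset X].

Definition degree (G : sgraph) (x : G) : nat := #|[set y | adj x y]|.

Definition min_degree_ge (G : sgraph) (k : nat) : Prop :=
  forall x : G, (k <= degree x)%N.

(* The vertex x of H becomes the branch vertex b x, and the edge xy becomes a
   path from b x to b y whose sequence of internal vertices is p x y (empty if
   the edge is not subdivided).  An edge of H has two orientations: the path of
   yx is that of xy reversed.  Only the values of p on edges matter.  The last
   two clauses say that S has no other vertices and no other edges. *)
Definition is_subdivision (H S : sgraph) : Prop :=
  exists (b : H -> S) (p : H -> H -> seq S),
  let full_path x y := b x :: rcons (p x y) (b y) in
  [/\ injective b,
      forall x y, adj x y ->
        [/\ path (@adj S) (b x) (rcons (p x y) (b y)),
            uniq (full_path x y) & p y x = rev (p x y)],
      (forall x y z, adj x y -> b z \notin p x y) /\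
      (forall x y x' y', adj x y -> adj x' y' -> [set x; y] != [set x'; y'] ->
        [disjoint p x y & p x' y']),
      forall u : S, (exists x, u = b x) \/
                    (exists x y, adj x y /\ u \in p x y)
    & forall u v : S, adj u v ->
        exists x y, adj x y /\ infix [:: u; v] (full_path x y)].

(* G has a (not necessarily induced) subgraph isomorphic to S whose vertex set
   is W. *)
Definition has_copy_on (S G : sgraph) (W : {set G}) : Prop :=
  exists phi : S -> G,
  [/\ injective phi, {homo phi : x y / adj x y} & phi @: [set: S] = W].

Definition perfect_subdivision_tiling (H G : sgraph) : Prop :=
  exists P : {set {set G}}, partition P [set: G] /\
    forall W, W \in P -> exists S : sgraph, is_subdivision H S /\ has_copy_on S W.

Definition forces_tiling (n : nat) (H : sgraph) (k : nat) : Prop :=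
  forall G : sgraph, #|G| = n -> min_degree_ge G k ->
    perfect_subdivision_tiling H G.

Lemma forces_tiling_exists (n : nat) (H : sgraph) :
  exists k, `[< forces_tiling n H k >].
Proof.
exists n; apply/asboolP => G Gn degG.
have G0 : G =i pred0.
  move=> x; have := degG x; rewrite leqNgt => /negP[].
  rewrite /degree -Gn -cardsT; apply/proper_card/properP; split.
    exact: subsetT.
  by exists x; rewrite ?inE ?adj_irrefl.
exists set0; split; last by move=> W; rewrite inE.
apply/and3P; split; last by rewrite inE.
  by rewrite /cover big_set0; apply/eqP/setP => x; have := G0 x; rewrite !inE.
by apply/trivIsetP => A B; rewrite inE.
Qed.

(* No negative integer is needed in the minimum: a minimum degree is
   nonnegative, and for n > 0 and H with an edge, k = 0 already fails on the
   edgeless graph. *)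
Definition delta_sub (n : nat) (H : sgraph) : nat :=
  ex_minn (forces_tiling_exists n H).

Local Open Scope ring_scope.

Definition f_H (H : sgraph) (X : {set H}) : rat :=
  (#|H| + #|induced_edges X| + #|induced_edges (~: X)|)%N%:R
  / (#|X| + #|induced_edges (~: X)|)%N%:R.

Definition xi (H : sgraph) : rat :=
  \big[Order.min/@f_H H set0]_(X : {set H}) f_H X.

Definition C_xi (H : sgraph) : seq int :=
  [seq (#|X| + #|induced_edges (~: X)|)%N%:Z
       - (#|~: X| + #|induced_edges X|)%N%:Z | X : {set H}].

(* None stands for infinity. *)
Definition hcf_xi (H : sgraph) : option nat :=
  if all (pred1 0) (C_xi H) then None
  else Some (\big[gcdn/0%N]_(c <- C_xi H) `|c|%N).

Definition xi_star (H : sgraph) : rat :=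
  match hcf_xi H with
  | Some 1%N => xi H
  | Some 2%N => Order.max (3%:R / 2%:R) (xi H)
  | _ => 2%:R
  end.

(* Main.v *)
Require Import Defs.
From mathcomp Require Import all_boot all_order all_algebra.
From mathcomp Require Import boolp reals.
From mathcomp Require Import zify ring lra.

Set Implicit Arguments.
Unset Strict Implicit.
Unset Printing Implicit Defensive.

(** For [X] a set of vertices of [H], let [w X = side_weight X] be [#|X|] plus
    the number of edges of [H] outside [X].  Drawing [H] in a complete bipartite
    graph with the branch vertices in [X] on one side and the others on the other
    side, and subdividing once the edges inside the two parts, uses [w X] and
    [w (~: X)] vertices of the two sides; lengthening a path adds the same number
    to both.  Let [X0] minimise [w (~: X) / w X], and write [a = w X0] and
    [b = w (~: X0)].  Then [xi H = (a + b) / a], so that [1 - 1 / xi H] is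
    [b / (a + b)], and [C_xi H] is the set of differences [w X - w (~: X)].

    Lower bound.  A path of a subdivision cannot have two consecutive vertices in
    an independent set [c]; comparing with the subdivisions above, every tile has
    at least [b / a] times as many vertices outside [c] as inside
    ([drawn_independent]).  Hence a clique on [k] vertices joined to an
    independent set on the other [n - k] has no perfect tiling if
    [k < b n / (a + b)] ([forces_tiling_space]).  If every difference in [C_xi H]
    is a multiple of a natural number other than 1 and 2, a complete bipartite graph
    whose sides differ by 1 or 2 has no perfect tiling either
    ([forces_tiling_divisibility]); this forces the value 1/2.

    Upper bound 1/2.  Above minimum degree [n / 2], any two vertices are joined by
    a Hamiltonian path ([hamilton_connected]), so that a single subdivision of
    [H] spans the graph ([perfect_tiling_half]).

    Upper bound for [hcf_xi H = 1].  The possible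
    differences between the sides of tileable complete bipartite graphs form a
    subgroup of the integers, which contains [C_xi H] and hence is everything; so
    every large complete bipartite graph with side ratio strictly between [b / a]
    and [a / b] is tileable ([bip_tileable_interior]).  It remains to cover the
    graph by such pieces.  First, almost all vertices are covered by disjoint
    copies of [K_(t,t)] and of [K_(B t,A t)], where [B / A] is slightly above
    [b / a] ([almost_cover]).  As long as many vertices are uncovered, the degree
    condition gives many of them the same neighbours in more than the proportion
    [B / (A + B)] of some tile, by averaging and the pigeonhole principle; such a
    tile can be cut up into smaller tiles that cover some of these vertices too
    ([tile_refine]).  A bounded number of rounds of such improvements suffices.
    Then each uncovered vertex is assigned to a tile that contains many of its
    neighbours.  A tile of scale [t] absorbs a number of vertices proportional to
    [t] ([absorb_pair]), so the total capacity is a positive proportion of [n]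
    that does not depend on [t], and the uncovered vertices do not exceed it
    ([perfect_tiling_hcf1]). *)

(** * Finite sets *)

Lemma exists_subset_card (T : finType) (A : {set T}) m :
  m <= #|A| -> exists2 B : {set T}, B \subset A & #|B| = m.
Proof.
move=> mA; exists [set x in take m (enum A)].
  by apply/subsetP=> x; rewrite inE => /mem_take; rewrite mem_enum.
rewrite cardsE; move/card_uniqP: (take_uniq m (enum_uniq A)) => ->.
by rewrite size_take -cardE; case: ltngtP mA.
Qed.

Lemma exists_bijection_on (T U : finType) (A : {set T}) (B : {set U}) (u0 : U) :
  #|A| = #|B| -> exists f : T -> U, {in A &, injective f} /\ f @: A = B.
Proof.
move=> AB; pose f x := nth u0 (enum B) (index x (enum A)).
have iA x : x \in A -> index x (enum A) < size (enum B).
  by rewrite -cardE -AB cardE index_mem mem_enum.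
have fI : {in A &, injective f}.
  move=> x y xA yA /eqP; rewrite /f nth_uniq ?iA ?enum_uniq // => /eqP.
  have xE : x \in enum A by rewrite mem_enum.
  by move/(congr1 (nth x (enum A))); rewrite !nth_index ?mem_enum.
exists f; split=> //; apply/eqP; rewrite eqEcard card_in_imset // AB leqnn andbT.
by apply/subsetP=> _ /imsetP[x xA ->]; rewrite -mem_enum mem_nth ?iA.
Qed.

Lemma cardsU_disjoint (T : finType) (X Y : {set T}) :
  [disjoint X & Y] -> #|X :|: Y| = #|X| + #|Y|.
Proof. by rewrite -leq_card_setU => /eqP. Qed.

Lemma disjointUr (T : finType) (X Y Z : {set T}) :
  [disjoint X & Y] -> [disjoint X & Z] -> [disjoint X & Y :|: Z].
Proof. by rewrite -!setI_eq0 setIUr => /eqP-> /eqP->; rewrite setU0. Qed.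

Lemma disjointUl (T : finType) (X Y Z : {set T}) :
  [disjoint X & Z] -> [disjoint Y & Z] -> [disjoint X :|: Y & Z].
Proof. by rewrite -!setI_eq0 setIUl => /eqP-> /eqP->; rewrite setU0. Qed.

Lemma card_bigcup_disjoint (T I : finType) (D : {set I}) (F : I -> {set T}) :
  {in D &, forall i j, i != j -> [disjoint F i & F j]} ->
  #|\bigcup_(i in D) F i| = \sum_(i in D) #|F i|.
Proof.
elim: {D}#|D| {-2}D (erefl #|D|) => [|n IHn] D cD dF.
  by move/eqP: cD; rewrite cards_eq0 => /eqP->; rewrite !big_set0 cards0.
have [i iD] : exists i, i \in D by apply/card_gt0P; rewrite cD.
have sub j : j \in D :\ i -> j \in D by rewrite in_setD1 => /andP[].
rewrite !(big_setD1 i iD) /= cardsU_disjoint; last first.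
  apply/bigcup_disjointP => j; rewrite in_setD1 => /andP[ji jD].
  by apply: dF => //; rewrite eq_sym.
congr (_ + _); apply: IHn => [|j k /sub jD /sub kD]; last exact: dF.
by move: cD; rewrite (cardsD1 i) iD add1n => -[].
Qed.

Lemma sum_card_capI (T : finType) (D : {set {set T}}) (W X : {set T}) :
  partition D W -> \sum_(Z in D) #|X :&: Z| = #|X :&: W|.
Proof.
have cap (Z : {set T}) : #|X :&: Z| = \sum_(v in Z) (v \in X).
  rewrite -sum1_card big_mkcond [RHS]big_mkcond; apply: eq_bigr => v _.
  by rewrite inE; case: (v \in X); case: (v \in Z).
rewrite (eq_bigr _ (fun Z _ => cap Z)) cap.
by case/and3P => /eqP <- tD _; rewrite -(big_trivIset _ tD).
Qed.

Lemma card_ord_lt n k : k <= n -> #|[set i : 'I_n | i < k]| = k.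
Proof.
move=> kn; rewrite -sum1_card (eq_bigl (fun i : 'I_n => i < k)); last by move=> i; rewrite inE.
by rewrite (big_ord_narrow kn) sum1_card card_ord.
Qed.

Lemma pigeonhole_fiber (T U : finType) (f : T -> U) (A : {set T}) (B : {set U}) :
  0 < #|A| -> (forall x, x \in A -> f x \in B) ->
  exists2 y, y \in B & #|A| <= #|B| * #|[set x in A | f x == y]|.
Proof.
move=> A0 fB; apply/exists_inP; apply: contraT => /exists_inPn noy.
have lt_y y : y \in B -> #|B| * #|[set x in A | f x == y]| <= #|A|.-1.
  by move=> yB; rewrite -ltnS prednK // ltnNge noy.
have cA : #|A| = \sum_(y in B) #|[set x in A | f x == y]|.
  rewrite -sum1_card (partition_big f (mem B)) //=; apply: eq_bigr => y _.
  by rewrite -sum1_card; apply: eq_bigl => x; rewrite inE.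
have B0 : 0 < #|B|.
  by case/card_gt0P: A0 => x xA; apply/card_gt0P; exists (f x); exact: fB.
have : #|B| * #|A| <= #|B| * #|A|.-1.
  by rewrite {1}cA big_distrr /= -sum_nat_const; apply: leq_sum => y; exact: lt_y.
by rewrite leq_pmul2l // -ltnS prednK // ltnn.
Qed.

(** A value is exhausted once it has been used [q] times.  The elements treated so
    far exhaust too few values to block all the values allowed for the next one. *)
Lemma greedy_assignment (V X : finType) (x0 : X) (L : {set V}) (R : V -> {set X}) q :
  (forall v, v \in L -> #|L| <= q * #|R v|) ->
  exists s : V -> X, (forall v, v \in L -> s v \in R v) /\
    forall x, #|[set v in L | s v == x]| <= q.
Proof.
move=> HR; have : forall k (L' : {set V}), #|L'| = k -> L' \subset L ->
    exists s : V -> X, (forall v, v \in L' -> s v \in R v) /\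
    forall x, #|[set v in L' | s v == x]| <= q; last by move/(_ _ L erefl (subxx _)).
elim=> [|k IHk] L' cL' sL.
  exists (fun=> x0); move/eqP: cL'; rewrite cards_eq0 => /eqP->; split=> [v|x].
    by rewrite in_set0.
  by rewrite (_ : [set _ in _ | _] = set0) ?cards0 //; apply/setP=> v; rewrite !inE.
have [v vL'] : exists v, v \in L' by apply/card_gt0P; rewrite cL'.
have cLv : #|L' :\ v| = k by move: cL'; rewrite (cardsD1 v) vL' add1n => -[].
have [s [sR sq]] := IHk _ cLv (subset_trans (subsetDl _ _) sL).
pose fib x := [set u in L' :\ v | s u == x].
pose F := [set x | q <= #|fib x|].
have cF : q * #|F| <= k.
  rewrite mulnC -sum_nat_const -cLv -sum1_card.
  rewrite (partition_big s predT) //= [X in _ <= X](bigID (mem F)) /=.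
  apply: leq_trans (leq_addr _ _); apply: leq_sum => x.
  rewrite inE => /leq_trans; apply; rewrite -sum1_card.
  by apply: eq_leq; apply: eq_bigl => u; rewrite !inE.
have [x xR xF] : exists2 x, x \in R v & x \notin F.
  apply/exists_inP; apply: contraT => /exists_inPn noF.
  have : #|R v| <= #|F|.
    by apply/subset_leq_card/subsetP => x /noF; rewrite negbK.
  have := HR v (subsetP sL _ vL'); have := subset_leq_card sL; rewrite cL' => h1 h2 h3.
  have : q * #|R v| <= q * #|F| by rewrite leq_mul2l h3 orbT.
  by move=> h4; have := leq_trans h1 (leq_trans h2 (leq_trans h4 cF)); rewrite ltnn.
exists (fun u => if u == v then x else s u); split=> [u uL'|y].
  by case: eqP => [->//|/eqP uv]; apply: sR; rewrite !inE uv.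
have [->|xy] := eqVneq y x.
  apply: (@leq_trans #|v |: fib x|); last first.
    rewrite cardsU1 (leq_trans (leq_add (leq_b1 _) (leqnn _))) // add1n.
    by move: xF; rewrite inE -ltnNge.
  apply/subset_leq_card/subsetP => u; rewrite !inE => /andP[uL'].
  by have [//|uv] := eqVneq u v; rewrite uL' => ->.
apply: leq_trans (sq y); apply/subset_leq_card/subsetP => u; rewrite !inE => /andP[uL'].
by have [_|uv ->] := eqVneq u v; [rewrite eq_sym (negbTE xy)|rewrite uL'].
Qed.

(** * Partitions into prescribed pieces *)

Definition tiled_by (T : finType) (Pr : {set T} -> Prop) (W : {set T}) : Prop :=
  exists D : {set {set T}}, partition D W /\ forall A, A \in D -> Pr A.

Section TiledBy.
Variables (T : finType).
Implicit Types (Pr : {set T} -> Prop) (A B W : {set T}).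

Lemma tiled_by0 Pr : tiled_by Pr set0.
Proof.
exists set0; split; last by move=> A; rewrite inE.
by apply/and3P; split; rewrite ?inE // /cover ?big_set0 //; apply/trivIsetP=> A; rewrite inE.
Qed.

Lemma tiled_by1 Pr W : Pr W -> tiled_by Pr W.
Proof.
have [->|W0 PW] := eqVneq W set0; first by move=> _; exact: tiled_by0.
exists [set W]; split; last by move=> A; rewrite inE => /eqP->.
apply/and3P; split; rewrite /cover ?big_set1 // ?inE 1?eq_sym //.
by apply/trivIsetP=> A B; rewrite !inE => /eqP-> /eqP->; rewrite eqxx.
Qed.

Lemma tiled_byU Pr A B : [disjoint A & B] ->
  tiled_by Pr A -> tiled_by Pr B -> tiled_by Pr (A :|: B).
Proof.
move=> AB [D [/and3P[/eqP cD tD D0] PD]] [E [/and3P[/eqP cE tE E0] PE]].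
exists (D :|: E); split; last by move=> C; rewrite inE => /orP[/PD|/PE].
have DA C : C \in D -> C \subset A by move=> CD; rewrite -cD; apply: bigcup_sup CD.
have EB C : C \in E -> C \subset B by move=> CE; rewrite -cE; apply: bigcup_sup CE.
apply/and3P; split.
- by rewrite /cover bigcup_setU -/(cover D) -/(cover E) cD cE.
- apply/trivIsetP=> C1 C2; rewrite !inE => /orP[C1D|C1E] /orP[C2D|C2E] ne.
  + exact: (trivIsetP tD).
  + exact: disjointWl (DA _ C1D) (disjointWr (EB _ C2E) AB).
  + rewrite disjoint_sym.
    exact: disjointWl (DA _ C2D) (disjointWr (EB _ C1E) AB).
  + exact: (trivIsetP tE).
- by rewrite inE negb_or D0.
Qed.

Lemma partitionD1_piece (D : {set {set T}}) W A : partition D W -> A \in D ->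
  [/\ W = A :|: cover (D :\ A), [disjoint A & cover (D :\ A)] &
      partition (D :\ A) (cover (D :\ A))].
Proof.
case/and3P=> /eqP cD tD D0 AD; split.
- by rewrite -cD /cover (big_setD1 A AD).
- apply/bigcup_disjointP => B; rewrite !inE => /andP[BA BD].
  by apply: (trivIsetP tD) => //; rewrite eq_sym.
- apply/and3P; split=> //; last by rewrite inE negb_and D0 orbT.
  by apply/trivIsetP=> B C; rewrite !inE => /andP[_ BD] /andP[_ CD]; apply: (trivIsetP tD).
Qed.

Lemma tiled_by_ind Pr (K : {set T} -> Prop) W :
  K set0 ->
  (forall A B, Pr A -> [disjoint A & B] -> tiled_by Pr B -> K B -> K (A :|: B)) ->
  tiled_by Pr W -> K W.
Proof.
move=> K0 KS [D]; elim: {D}#|D| {-2}D (erefl #|D|) W => [|n IHn] D cardD W [pD PD].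
  move/eqP: cardD; rewrite cards_eq0 => /eqP D0; subst D.
  by case/and3P: pD => /eqP <- _ _; rewrite /cover big_set0.
have [A AD] : exists A, A \in D by apply/card_gt0P; rewrite cardD.
have [eW dA pD'] := partitionD1_piece pD AD.
have PD' B : B \in D :\ A -> Pr B by rewrite inE => /andP[_ /PD].
rewrite eW; apply: KS => //; first exact: PD.
  by exists (D :\ A).
apply: (IHn (D :\ A)) => //; move: cardD; rewrite (cardsD1 A) AD add1n.
by case.
Qed.

Lemma tiled_by_refine Pr Pr' W :
  (forall A, Pr A -> tiled_by Pr' A) -> tiled_by Pr W -> tiled_by Pr' W.
Proof.
move=> PP'; apply: tiled_by_ind => [|A B /PP' tA dAB _ tB]; first exact: tiled_by0.
exact: tiled_byU.
Qed.

End TiledBy.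

Lemma tiled_by_bigcup (T I : finType) (Pr : {set T} -> Prop) (D : {set I})
    (F : I -> {set T}) :
  {in D &, forall i j, i != j -> [disjoint F i & F j]} ->
  (forall i, i \in D -> tiled_by Pr (F i)) -> tiled_by Pr (\bigcup_(i in D) F i).
Proof.
elim: {D}#|D| {-2}D (erefl #|D|) => [|n IHn] D cD dF tF.
  by move/eqP: cD; rewrite cards_eq0 => /eqP->; rewrite big_set0; exact: tiled_by0.
have [i iD] : exists i, i \in D by apply/card_gt0P; rewrite cD.
have sub j : j \in D :\ i -> j \in D by rewrite in_setD1 => /andP[].
rewrite (big_setD1 i iD) /=; apply: tiled_byU; last first.
- apply: IHn => [|j k /sub jD /sub kD|j /sub]; [|exact: dF|exact: tF].
  by move: cD; rewrite (cardsD1 i) iD add1n => -[].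
- exact: tF.
- apply/bigcup_disjointP => j; rewrite in_setD1 => /andP[ji jD].
  by apply: dF => //; rewrite eq_sym.
Qed.

Lemma chunk_cover (T : finType) (c : nat) (U : {set T}) : 0 < c ->
  exists2 U0 : {set T}, U0 \subset U &
    tiled_by (fun Z : {set T} => #|Z| = c) U0 /\ #|U :\: U0| < c.
Proof.
move=> c0; elim: {U}#|U| {-2}U (leqnn #|U|) => [|n IHn] U leU.
  exists set0; rewrite ?sub0set // setD0; split; first exact: tiled_by0.
  by apply: leq_ltn_trans leU _.
have [ltUc|cU] := ltnP #|U| c.
  by exists set0; rewrite ?sub0set // setD0; split=> //; exact: tiled_by0.
have [Z ZU cZ] := exists_subset_card cU.
have [|U0 sU0 [tU0 lt]] := IHn (U :\: Z).
  by rewrite cardsDS // cZ leq_subLR; apply: leq_trans leU _; rewrite -add1n leq_add2r.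
exists (Z :|: U0); first by rewrite subUset ZU (subset_trans sU0) ?subsetDl.
split; last by rewrite -setDDl.
apply: tiled_byU => //; last exact: tiled_by1.
rewrite disjoint_sym disjoints_subset; apply: subset_trans sU0 _.
by rewrite setDE subsetIr.
Qed.

(** * Subdivisions drawn inside a host graph *)

(** Keeping the subdivision inside the host graph, instead of as a graph of its own
    with an embedding, allows it to be built and lengthened step by step. *)
Definition drawing (H G : sgraph) (b : H -> G) (p : H -> H -> seq G)
    (W : {set G}) : Prop :=
  [/\ injective b,
      forall x y, adj x y ->
        [/\ path (@adj G) (b x) (rcons (p x y) (b y)),
            uniq (b x :: rcons (p x y) (b y)) & p y x = rev (p x y)],
      forall x y z, adj x y -> b z \notin p x y,
      forall x y x' y', adj x y -> adj x' y' -> [set x; y] != [set x'; y'] ->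
        [disjoint p x y & p x' y']
    & forall u, u \in W <->
        (exists x, u = b x) \/ (exists x y, adj x y /\ u \in p x y)].

Definition drawn_on (H G : sgraph) (W : {set G}) : Prop :=
  exists b p, @drawing H G b p W.

Lemma path_of_infix (T : eqType) (e : rel T) x s :
  (forall u v, infix [:: u; v] (x :: s) -> e u v) -> path e x s.
Proof.
elim: s x => [//|y s IHs] x He; rewrite -[path _ _ _]/(e x y && path e y s); apply/andP; split.
  by apply: He; rewrite /= !eqxx prefix0s.
by apply: IHs => u v uv; apply: He; rewrite infix_consl uv orbT.
Qed.

Lemma infix2_path (T : eqType) (e : rel T) x s u v :
  path e x s -> infix [:: u; v] (x :: s) -> e u v.
Proof.
elim: s x => [|y s IHs] x; first by rewrite /= andbF.
rewrite -[path _ _ _]/(e x y && path e y s) => /andP[xy ys]; rewrite infix_consl => /orP[|]; last exact: IHs.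
by move=> /= /andP[/eqP-> /andP[/eqP-> _]].
Qed.

Lemma infix_map_inj (T1 T2 : eqType) (f : T1 -> T2) s1 s2 :
  injective f -> infix (map f s1) (map f s2) = infix s1 s2.
Proof.
move=> fI; elim: s2 => [|x s2 IH]; first by rewrite !infixs0; case: s1.
rewrite map_cons !infix_consl IH; congr (_ || _).
by rewrite -map_cons !prefixE size_map -map_take (inj_eq (inj_map fI)).
Qed.

Lemma drawn_of_copy (H G : sgraph) (W : {set G}) (S : sgraph) :
  is_subdivision H S -> has_copy_on S W -> drawn_on H W.
Proof.
case=> b [p [bI Hp [Hb Hd] HV _]] [phi [phiI phiH phiW]].
exists (phi \o b), (fun x y => map phi (p x y)); split.
- exact: inj_comp.
- move=> x y xy; have [pth un rv] := Hp _ _ xy; split.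
  + rewrite /= -map_rcons path_map; apply: sub_path pth => u v; exact: phiH.
  + by rewrite -map_rcons -[(_ \o _) x :: _]/(map phi (b x :: _)) map_inj_uniq.
  + by rewrite rv map_rev.
- by move=> x y z xy; rewrite /= mem_map //; apply: Hb.
- move=> x y x' y' xy xy' ne; have := Hd _ _ _ _ xy xy' ne.
  rewrite !disjoint_has; apply: contra => /hasP[u /mapP[v vp ->]].
  by rewrite mem_map // => vp'; apply/hasP; exists v.
- move=> u; rewrite -phiW; split.
  + case/imsetP=> v _ ->; have [[x ->]|[x [y [xy vp]]]] := HV v.
      by left; exists x.
    by right; exists x, y; split=> //; rewrite map_f.
  + case=> [[x ->]|[x [y [xy /mapP[v _ ->]]]]]; exact: imset_f.
Qed.

Lemma copy_of_drawn (H G : sgraph) (W : {set G}) :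
  drawn_on H W -> exists S : sgraph, is_subdivision H S /\ has_copy_on S W.
Proof.
case=> b [p [bI Hp Hb Hd HV]].
pose full x y := b x :: rcons (p x y) (b y).
have fullC x y : adj x y -> full y x = rev (full x y).
  by move=> xy; rewrite /full; case: (Hp _ _ xy) => _ _ ->; rewrite rev_cons rev_rcons.
pose e (u v : {u : G | u \in W}) :=
  [exists x, exists y, adj x y && infix [:: val u; val v] (full x y)].
have eS : symmetric e.
  suff e1 u v : e u v -> e v u by move=> u v; apply/idP/idP; apply: e1.
  case/existsP=> x /existsP[y /andP[xy uv]].
  apply/existsP; exists y; apply/existsP; exists x; rewrite adj_sym xy andTb.
  by rewrite fullC // -[[:: val v; val u]]/(rev [:: val u; val v]) infix_rev.
have eI : irreflexive e.
  move=> u; apply/existsP=> -[x /existsP[y /andP[xy uv]]].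
  have [_ un _] := Hp _ _ xy.
  by have := infix_uniq uv un; rewrite /= inE eqxx.
pose S := SGraph eS eI.
have bW x : b x \in W by apply/HV; left; exists x.
have pW x y : adj x y -> all (mem W) (p x y).
  by move=> xy; apply/allP=> u up; apply/HV; right; exists x, y.
pose b' x : S := Sub (b x) (bW x).
pose p' x y : seq S := pmap insub (p x y).
have valp' x y : adj x y -> map val (p' x y) = p x y.
  move=> xy; rewrite /p' pmap_filter; last exact: insubK.
  by apply/all_filterP; apply: sub_all (pW _ _ xy) => u /= uW; rewrite insubT.
have vfull x y : adj x y -> map val (b' x :: rcons (p' x y) (b' y)) = full x y.
  by move=> xy; rewrite /= map_rcons valp'.
have vI : injective (val : S -> G) by exact: val_inj.
exists S; split; last first.
  exists (val : S -> G); split.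
  - exact: vI.
  - move=> u v /existsP[x /existsP[y /andP[xy uv]]].
    by case: (Hp _ _ xy) => pth _ _; exact: infix2_path uv.
  - apply/setP=> u; apply/imsetP/idP => [[v _ ->]|uW]; first exact: (valP v).
    by exists (Sub u uW : S) => //; rewrite inE.
exists b', p'; split.
- by move=> x y /(congr1 val) /= /bI.
- move=> x y xy; have [pth un rv] := Hp _ _ xy; split.
  + apply: path_of_infix => u v uv.
    apply/existsP; exists x; apply/existsP; exists y; rewrite xy andTb.
    by rewrite -vfull // -[[:: val u; val v]]/(map val [:: u; v]) infix_map_inj.
  + by rewrite -(map_inj_uniq vI) vfull.
  + apply: (inj_map vI); rewrite map_rev valp' ?valp' //.
    by rewrite adj_sym.
- split=> [x y z xy|x y x' y' xy xy' ne].
    by rewrite -(mem_map vI) valp' //; apply: Hb.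
  have := Hd _ _ _ _ xy xy' ne; rewrite !disjoint_has; apply: contra.
  case/hasP=> u up up'; apply/hasP; exists (val u).
    by rewrite -(valp' _ _ xy) map_f.
  by rewrite -(valp' _ _ xy') map_f.
- move=> u; have /HV[[x ux]|[x [y [xy ux]]]] := valP u.
    by left; exists x; apply: val_inj.
  by right; exists x, y; split=> //; rewrite -(mem_map vI) valp'.
- move=> u v /existsP[x /existsP[y /andP[xy uv]]]; exists x, y; split=> //.
  by rewrite -(infix_map_inj _ _ vI) vfull.
Qed.

Lemma perfect_tilingP (H G : sgraph) :
  perfect_subdivision_tiling H G <-> tiled_by (@drawn_on H G) [set: G].
Proof.
split=> -[D [pD HD]]; exists D; split=> // A /HD.
  by case=> S [HS cS]; exact: drawn_of_copy HS cS.
exact: copy_of_drawn.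
Qed.

Lemma edgesP (G : sgraph) (e : {set G}) :
  reflect (exists x y, adj x y /\ e = [set x; y]) (e \in edges G).
Proof.
rewrite inE; apply: (iffP existsP) => [[x /existsP[y /andP[xy /eqP->]]]|].
  by exists x, y.
by case=> x [y [xy ->]]; exists x; apply/existsP; exists y; rewrite xy eqxx.
Qed.

Lemma edge_set2 (G : sgraph) (x y : G) : adj x y -> [set x; y] \in edges G.
Proof. by move=> xy; apply/edgesP; exists x, y. Qed.

Lemma induced_edgesP (H : sgraph) (X : {set H}) x y :
  adj x y -> ([set x; y] \in induced_edges X) = (x \in X) && (y \in X).
Proof. by move=> xy; rewrite inE edge_set2 //= subUset !sub1set. Qed.

(** With at most one subdividing vertex on each edge, a path and its reversal have
    the same internal vertices, so that the paths can be indexed by edges. *)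
Lemma drawing_of_midpoints (H G : sgraph) (b : H -> G) (m : {set H} -> option G)
    (W : {set G}) :
  injective b ->
  (forall x y, adj x y -> m [set x; y] = None -> adj (b x) (b y)) ->
  (forall x y z, adj x y -> m [set x; y] = Some z ->
     adj (b x) z /\ forall w, b w != z) ->
  (forall e e' z, e \in edges H -> e' \in edges H ->
     m e = Some z -> m e' = Some z -> e = e') ->
  (forall u, u \in W <->
     (exists x, u = b x) \/ (exists2 e, e \in edges H & m e = Some u)) ->
  drawing b (fun x y => seq_of_opt (m [set x; y])) W.
Proof.
move=> bI mN mS mI HW; split=> //.
- move=> x y xy; have yx : adj y x by rewrite adj_sym.
  have bxy : b x != b y.
    by rewrite (inj_eq bI); apply: contraTneq xy => ->; rewrite adj_irrefl.
  rewrite (setUC [set y]); case mxy: (m [set x; y]) => [z|]; last first.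
    by rewrite /= mN //= inE bxy.
  have [bxz Hz] := mS _ _ _ xy mxy.
  have /(mS _ _ _ yx)[byz _] : m [set y; x] = Some z by rewrite setUC.
  by rewrite /= !inE bxz adj_sym byz (negbTE bxy) orbF Hz eq_sym Hz.
- move=> x y z xy; case mxy: (m [set x; y]) => [w|] //=.
  by have [_ Hz] := mS _ _ _ xy mxy; rewrite inE; exact: Hz.
- move=> x y x' y' xy xy'; case mxy: (m [set x; y]) => [w|] /=.
    case mxy': (m [set x'; y']) => [w'|] /= ne; last by rewrite disjoint_has.
    rewrite disjoint_has /= orbF inE; apply: contra ne => /eqP ww.
    apply/eqP; apply: (mI _ _ w'); rewrite ?edge_set2 //.
    by rewrite mxy ww.
  by rewrite disjoint_has.
- move=> u; rewrite HW; split=> -[?|]; try by left.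
    case=> e /edgesP[x [y [xy ->]]] mu; right; exists x, y.
    by rewrite mu /= inE.
  case=> x [y [xy]]; case mxy: (m [set x; y]) => [w|] //=.
  by rewrite inE => /eqP->; right; exists [set x; y] => //; exact: edge_set2.
Qed.

Lemma drawing_mono (H G : sgraph) (e : rel G) (eS : symmetric e)
    (eI : irreflexive e) b p (W : {set G}) :
  subrel e (@adj G) -> @drawing H (SGraph eS eI) b p W -> @drawing H G b p W.
Proof.
move=> sub [bI Hp Hb Hd HW]; split=> // x y xy.
by have [pth un rv] := Hp _ _ xy; split=> //; apply: sub_path pth.
Qed.

Lemma drawing_next_adj (H G : sgraph) (b : H -> G) p W x0 y0 :
  drawing b p W -> adj x0 y0 -> adj (b x0) (head (b y0) (p x0 y0)).
Proof.
by case=> _ Hp _ _ _ xy; have [pth _ _] := Hp _ _ xy; case: (p x0 y0) pth => [|z s] /= /andP[].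
Qed.

(** Inserting [l] right after the first vertex of a path leaves the rest of the
    drawing alone.  This serves both to lengthen a path by two vertices and to let
    a single path run through all the remaining vertices of the host graph. *)
Lemma drawing_insert (H G : sgraph) (b : H -> G) p W x0 y0 (l : seq G) :
  drawing b p W -> adj x0 y0 ->
  path (@adj G) (b x0) (rcons l (head (b y0) (p x0 y0))) ->
  uniq l -> [disjoint l & W] ->
  exists p', drawing b p' (W :|: [set u in l]).
Proof.
case=> bI Hp Hb Hd HW xy0 lpth lun ldis.
pose p' x y := if (x, y) == (x0, y0) then l ++ p x0 y0
  else if (x, y) == (y0, x0) then rev (l ++ p x0 y0) else p x y.
have ne0 : (x0, y0) != (y0, x0).
  by rewrite xpair_eqE negb_and; case: eqP xy0 => // <-; rewrite adj_irrefl.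
have nlW u : u \in l -> u \in W -> False.
  by move=> ul uW; have := disjointFr ldis ul; rewrite uW.
have bW x : b x \in W by apply/HW; left; exists x.
have pW x y u : adj x y -> u \in p x y -> u \in W.
  by move=> xy up; apply/HW; right; exists x, y.
have p'00 : p' x0 y0 = l ++ p x0 y0 by rewrite /p' eqxx.
have p'10 : p' y0 x0 = rev (l ++ p x0 y0).
  by rewrite /p' eq_sym (negbTE ne0) eqxx.
have p'n x y : [set x; y] != [set x0; y0] -> p' x y = p x y.
  rewrite /p' => ne; case: eqP => [[ex ey]|_]; first by rewrite ex ey eqxx in ne.
  by case: eqP => [[ex ey]|_] //; rewrite ex ey setUC eqxx in ne.
have memp' x y u : adj x y -> u \in p' x y -> u \in p x y \/
    u \in l /\ [set x; y] = [set x0; y0].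
  move=> xy; rewrite /p'; case: eqP => [[-> ->]|_].
    by rewrite mem_cat => /orP[]; [right|left].
  case: eqP => [[-> ->]|_]; last by left.
  rewrite mem_rev mem_cat => /orP[]; first by right; rewrite setUC.
  by case: (Hp _ _ xy0) => _ _ -> up; left; rewrite mem_rev.
have good x y : adj x y ->
    [/\ path (@adj G) (b x) (rcons (p x y) (b y)),
        uniq (b x :: rcons (p x y) (b y)) & p y x = rev (p x y)] /\
    ((x, y) = (x0, y0) -> 
    [/\ path (@adj G) (b x) (rcons (l ++ p x y) (b y)) &
        uniq (b x :: rcons (l ++ p x y) (b y))]).
  move=> xy; split; first exact: Hp.
  case=> ex ey; subst x y; have [pth un _] := Hp _ _ xy0; split.
    rewrite rcons_cat cat_path; move: lpth; rewrite rcons_path => /andP[-> lh] /=.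
    by move: pth lh; case: (p x0 y0) => [|z s] /= /andP[_ zs] ->.
  rewrite rcons_cat cons_uniq cat_uniq mem_cat negb_or lun /=.
  move: un; rewrite /= => /andP[-> ->]; rewrite !andbT.
  apply/andP; split; first by apply/negP => /nlW /(_ (bW _)).
  apply/hasPn => u; rewrite mem_rcons inE => /orP[/eqP->|/(pW _ _ _ xy0) uW].
    by apply/negP => /nlW /(_ (bW _)).
  by apply/negP => /nlW /(_ uW).
have revpath x y s : path (@adj G) x (rcons s y) ->
    path (@adj G) y (rcons (rev s) x).
  move=> ps; rewrite -rev_cons.
  have := rev_path (@adj G) x (rcons s y); rewrite last_rcons belast_rcons => ->.
  by rewrite (eq_path (e' := @adj G)) // => u v; rewrite adj_sym.
exists p'; split=> //.
- move=> x y xy; have [[pth un rv] g0] := good _ _ xy.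
  have [e0|e0] := (x, y) =P (x0, y0).
    have [gp gu] := g0 e0; case: e0 => ex ey; subst x y.
    by rewrite p'00 p'10; split.
  have [e1|e1] := (x, y) =P (y0, x0).
    case: e1 => ex ey; subst x y.
    have [_ /(_ erefl) [gp gu]] := good _ _ xy0.
    rewrite p'00 p'10 revK; split=> //; first exact: revpath.
    by rewrite -rcons_cons -rev_rcons -rev_cons rev_uniq.
  have ne : [set x; y] != [set x0; y0].
    apply/eqP=> E; have : x \in [set x0; y0] by rewrite -E !inE eqxx.
    have : y \in [set x0; y0] by rewrite -E !inE eqxx orbT.
    rewrite !inE => /orP[] /eqP ey /orP[] /eqP ex; subst x y.
    - by rewrite adj_irrefl in xy.
    - by case: e1.
    - by case: e0.
    - by rewrite adj_irrefl in xy.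
  by rewrite !p'n // setUC.
- move=> x y z xy; apply/negP => /(memp' _ _ _ xy)[|[bl _]].
    exact/negP/Hb.
  exact: nlW bl (bW z).
- move=> x y x' y' xy xy' ne; rewrite disjoint_has; apply/hasPn => u.
  move=> /(memp' _ _ _ xy)up; apply/negP=> /(memp' _ _ _ xy')up'.
  case: up up' => [up|[ul E]] [up'|[ul' E']].
  - by have := disjointFr (Hd _ _ _ _ xy xy' ne) up; rewrite up'.
  - exact: nlW ul' (pW _ _ _ xy up).
  - exact: nlW ul (pW _ _ _ xy' up').
  - by rewrite E E' eqxx in ne.
- move=> u; rewrite !inE; split.
    case/orP=> [/HW[?|[x [y [xy up]]]]|ul]; first by left.
      right; exists x, y; split=> //; rewrite /p'.
      case: eqP => [[<- <-]|_]; first by rewrite mem_cat up orbT.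
      case: eqP => [[ex ey]|_] //; rewrite mem_rev mem_cat.
      have [_ _ rv] := Hp _ _ xy; subst x y; rewrite rv mem_rev up orbT //.
    by right; exists x0, y0; rewrite p'00 mem_cat ul.
  case=> [[x ->]|[x [y [xy /(memp' _ _ _ xy)[/(pW _ _ _ xy) ->//|[-> _]]]]]].
    by rewrite bW.
  by rewrite orbT.
Qed.

(** * Subdivisions in complete bipartite graphs *)

Definition complete_between (G : sgraph) (P Q : {set G}) : Prop :=
  forall u v, u \in P -> v \in Q -> adj u v.

Lemma complete_between_disjoint (G : sgraph) (P Q : {set G}) :
  complete_between P Q -> [disjoint P & Q].
Proof.
move=> PQ; rewrite -setI_eq0; apply/eqP/setP=> u; rewrite !inE.
by apply/andP=> -[uP uQ]; have := PQ u u uP uQ; rewrite adj_irrefl.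
Qed.

Lemma complete_between_sym (G : sgraph) (P Q : {set G}) :
  complete_between P Q -> complete_between Q P.
Proof. by move=> PQ u v uQ vP; rewrite adj_sym PQ. Qed.

Lemma complete_betweenS (G : sgraph) (P Q P' Q' : {set G}) :
  P' \subset P -> Q' \subset Q -> complete_between P Q -> complete_between P' Q'.
Proof. by move=> /subsetP sP /subsetP sQ PQ u v /sP uP /sQ; apply: PQ. Qed.

Lemma complete_betweenU (G : sgraph) (P Q Q' : {set G}) :
  complete_between P Q -> complete_between P Q' -> complete_between P (Q :|: Q').
Proof. by move=> h h' u v uP; rewrite inE => /orP[]; [exact: h|exact: h']. Qed.

(** The number of vertices on the side of [X] in the most economical bipartite
    subdivision of [H] whose branch vertices are split as [X], [~: X]: every edge
    inside [~: X] gets one subdividing vertex there. *)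
Definition side_weight (H : sgraph) (X : {set H}) : nat :=
  #|X| + #|induced_edges (~: X)|.

Lemma side_weight_gt0 (H : sgraph) (X : {set H}) :
  0 < #|edges H| -> 0 < side_weight X.
Proof.
move=> /card_gt0P[e eE]; rewrite /side_weight addn_gt0.
have [->|X0] := eqVneq X set0; last by rewrite card_gt0 X0.
apply/orP; right; apply/card_gt0P; exists e.
by rewrite inE eE setC0 subsetT.
Qed.

Lemma drawing_bipartite_base (H G : sgraph) (X : {set H}) (P Q : {set G}) :
  complete_between P Q -> #|P| = side_weight X -> #|Q| = side_weight (~: X) ->
  0 < #|P| -> exists b p, @drawing H G b p (P :|: Q).
Proof.
move=> PQ cP cQ /card_gt0P[z0 _].
pose side (Y : {set H}) : {set (H + {set H})} :=
  [set inl x | x in Y] :|: [set inr e | e in induced_edges (~: Y)].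
have card_side Y : #|side Y| = side_weight Y.
  rewrite /side /side_weight cardsU !card_imset => [|? ? []//|? ? []//].
  rewrite (_ : _ :&: _ = set0) ?cards0 ?subn0 //; apply/setP=> u; rewrite !inE.
  by apply/andP=> -[/imsetP[? _ ->] /imsetP[]].
have inlS Y x : (inl x \in side Y) = (x \in Y).
  rewrite inE; apply/orP/idP => [[/imsetP[? ? [->]]|/imsetP[]]//|xY].
  by left; apply: imset_f.
have inrS Y e : (inr e \in side Y) = (e \in induced_edges (~: Y)).
  rewrite inE; apply/orP/idP => [[/imsetP[]//|/imsetP[? ? [->]]]//|eY].
  by right; apply: imset_f.
have [f1 [f1I f1P]] := exists_bijection_on z0 (etrans (card_side X) (esym cP)).
have [f2 [f2I f2Q]] := exists_bijection_on z0 (etrans (card_side (~: X)) (esym cQ)).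
have dPQ := complete_between_disjoint PQ.
have f1P' s : s \in side X -> f1 s \in P by move=> sX; rewrite -f1P imset_f.
have f2Q' s : s \in side (~: X) -> f2 s \in Q by move=> sX; rewrite -f2Q imset_f.
have nPQ u v : u \in P -> v \in Q -> u != v.
  by move=> uP vQ; apply: contraTneq vQ => <-; rewrite (disjointFr dPQ uP).
pose b x := if x \in X then f1 (inl x) else f2 (inl x).
pose m e := if e \in induced_edges X then Some (f2 (inr e)) else
  if e \in induced_edges (~: X) then Some (f1 (inr e)) else None.
have inX x : x \in X -> inl x \in side X by rewrite inlS.
have inY x : x \notin X -> inl x \in side (~: X) by rewrite inlS inE.
have einX e : e \in induced_edges X -> inr e \in side (~: X) by rewrite inrS setCK.
have einY e : e \in induced_edges (~: X) -> inr e \in side X by rewrite inrS.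
exists b, (fun x y => seq_of_opt (m [set x; y])).
apply: drawing_of_midpoints.
- move=> x y; rewrite /b; case: ifPn => xX; case: ifPn => yX bxy.
  + by have [] := f1I _ _ (inX _ xX) (inX _ yX) bxy.
  + by have := nPQ _ _ (f1P' _ (inX _ xX)) (f2Q' _ (inY _ yX)); rewrite bxy eqxx.
  + by have := nPQ _ _ (f1P' _ (inX _ yX)) (f2Q' _ (inY _ xX)); rewrite bxy eqxx.
  + by have [] := f2I _ _ (inY _ xX) (inY _ yX) bxy.
- move=> x y xy; rewrite /m /b !induced_edgesP // !inE.
  case: (boolP (x \in X)) => xX; case: (boolP (y \in X)) => yX //= _.
    by apply: PQ; [apply: f1P'; exact: inX|apply: f2Q'; exact: inY].
  by rewrite adj_sym; apply: PQ; [apply: f1P'; exact: inX|apply: f2Q'; exact: inY].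
- move=> x y z xy; rewrite /m; case: ifPn => [eX [<-]|eX].
    have := eX; rewrite induced_edgesP // => /andP[xX yX].
    split; first by rewrite /b xX; apply: PQ; [exact/f1P'/inX|exact/f2Q'/einX].
    move=> w; rewrite /b; case: ifPn => wX.
      by apply: nPQ; [exact/f1P'/inX|exact/f2Q'/einX].
    by apply/eqP => /(f2I _ _ (inY _ wX) (einX _ eX)).
  case: ifPn => // eY [<-].
  have := eY; rewrite induced_edgesP // !inE => /andP[xX yX].
  split.
    by rewrite /b (negbTE xX) adj_sym; apply: PQ; [exact/f1P'/einY|exact/f2Q'/inY].
  move=> w; rewrite /b; case: ifPn => wX.
    by apply/eqP => /(f1I _ _ (inX _ wX) (einY _ eY)).
  by rewrite eq_sym; apply: nPQ; [exact/f1P'/einY|exact/f2Q'/inY].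
- move=> e e' z eE e'E; rewrite /m.
  case: ifPn => [eX [<-]|eX]; [|case: ifPn => // eY [<-]];
   (case: ifPn => [e'X|e'X]; [case=> E|case: ifPn => // e'Y; case=> E]).
  + by have [] := f2I _ _ (einX _ e'X) (einX _ eX) E.
  + by have := nPQ _ _ (f1P' _ (einY _ e'Y)) (f2Q' _ (einX _ eX)); rewrite E eqxx.
  + by have := nPQ _ _ (f1P' _ (einY _ eY)) (f2Q' _ (einX _ e'X)); rewrite E eqxx.
  + by have [] := f1I _ _ (einY _ e'Y) (einY _ eY) E.
- have disjXY e : e \in induced_edges (~: X) -> e \notin induced_edges X.
    rewrite inE => /andP[/edgesP[x [y [xy ->]]]].
    by rewrite induced_edgesP // subUset !sub1set !inE => /andP[/negbTE->].
  move=> u; rewrite inE -{1}f1P -{1}f2Q; split.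
    case/orP=> /imsetP[[x|e]].
    + by rewrite inlS => xX ->; left; exists x; rewrite /b xX.
    + rewrite inrS => eY ->; right; exists e; first by case/setIdP: eY.
      by rewrite /m (negbTE (disjXY _ eY)) eY.
    + by rewrite inlS inE => xX ->; left; exists x; rewrite /b (negbTE xX).
    + rewrite inrS setCK => eX ->; right; exists e; first by case/setIdP: eX.
      by rewrite /m eX.
  case=> [[x ->]|[e eE]]; rewrite ?f1P ?f2Q.
    rewrite /b; case: ifPn => xX; first by rewrite f1P' // inX.
    by rewrite f2Q' ?orbT // inY.
  rewrite /m; case: ifPn => [eX [<-]|_]; first by rewrite f2Q' ?orbT // einX.
  by case: ifPn => // eY [<-]; rewrite f1P' // einY.
Qed.

(** Any edge of a subdivision drawn in a bipartite graph can be replaced by a path of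
    length three, with one new vertex on each side. *)
Lemma drawing_bipartite_ext (H G : sgraph) (X : {set H}) (c : {set G}) :
  0 < #|edges H| -> (forall u v, adj u v -> (u \in c) != (v \in c)) ->
  forall k (P Q : {set G}), P \subset c -> Q \subset ~: c ->
  complete_between P Q -> #|P| = side_weight X + k ->
  #|Q| = side_weight (~: X) + k -> exists b p, @drawing H G b p (P :|: Q).
Proof.
move=> eH bip; elim=> [|k IHk] P Q sP sQ PQ cP cQ.
  rewrite !addn0 in cP cQ; apply: (drawing_bipartite_base PQ cP cQ).
  by rewrite cP side_weight_gt0.
have [u uP] : exists u, u \in P by apply/card_gt0P; rewrite cP addnS.
have [w wQ] : exists w, w \in Q by apply/card_gt0P; rewrite cQ addnS.
have sP' : P :\ u \subset P by apply: subsetDl.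
have sQ' : Q :\ w \subset Q by apply: subsetDl.
have cP' : #|P :\ u| = side_weight X + k.
  by move: cP; rewrite (cardsD1 u) uP addnS => -[].
have cQ' : #|Q :\ w| = side_weight (~: X) + k.
  by move: cQ; rewrite (cardsD1 w) wQ addnS => -[].
have [b [p dr]] := IHk (P :\ u) (Q :\ w) (subset_trans sP' sP)
  (subset_trans sQ' sQ) (complete_betweenS sP' sQ' PQ) cP' cQ'.
case/card_gt0P: eH => _ /edgesP[x0 [y0 [xy0 _]]].
have [bI Hp _ _ HW] := dr.
have bxW : b x0 \in P :\ u :|: Q :\ w by apply/HW; left; exists x0.
set z := head (b y0) (p x0 y0).
have zW : z \in P :\ u :|: Q :\ w.
  apply/HW; rewrite /z; case E: (p x0 y0) => [|z' s]; first by left; exists y0.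
  by right; exists x0, y0; split=> //; rewrite E /= inE eqxx.
have bz : adj (b x0) z := drawing_next_adj dr xy0.
have nc : (b x0 \in c) != (z \in c) := bip _ _ bz.
have uc : u \in c := subsetP sP _ uP.
have wc : w \notin c by have := subsetP sQ _ wQ; rewrite inE.
have inPQ v : v \in P :\ u :|: Q :\ w ->
    (v \in c -> v \in P) /\ (v \notin c -> v \in Q).
  rewrite !inE => /orP[/andP[_ vP]|/andP[_ vQ]].
    by split=> // /negP[]; apply: (subsetP sP).
  by split=> // vc; have := subsetP sQ _ vQ; rewrite inE vc.
have [bP bQ] := inPQ _ bxW; have [zP zQ] := inPQ _ zW.
have uw : u != w by apply: contraNneq wc => <-.
have dis l : perm_eq l [:: u; w] -> [disjoint l & P :\ u :|: Q :\ w].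
  move=> pl; rewrite disjoint_has; apply/hasPn => v; rewrite (perm_mem pl) !inE.
  have dPQ := complete_between_disjoint PQ.
  case/orP=> /eqP->; rewrite ?uw eqxx ?andbF ?orbF /=.
    by rewrite (disjointFr dPQ uP).
  by rewrite (disjointFl dPQ wQ) andbF.
have finish l : perm_eq l [:: u; w] -> path (@adj G) (b x0) (rcons l z) ->
    exists b p, @drawing H G b p (P :|: Q).
  move=> pl lp; have ul : uniq l by rewrite (perm_uniq pl) /= inE uw.
  have [p' dr'] := drawing_insert dr xy0 lp ul (dis _ pl).
  exists b, p'; congr (drawing _ _ _): dr'; apply/setP=> v.
  rewrite !inE (perm_mem pl) !inE.
  case: (eqVneq v u) => [->|vu]; first by rewrite uP orbT.
  by case: (eqVneq v w) => [->|vw]; rewrite ?wQ ?orbT ?orbF.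
have [bc|bc] := boolP (b x0 \in c).
  have zc : z \notin c by move: nc; rewrite bc; case: (z \in c).
  apply: (finish [:: w; u]); first by rewrite (perm_catC [:: w] [:: u]).
  by rewrite /= (PQ _ _ (bP bc) wQ) (PQ _ _ uP (zQ zc)) adj_sym PQ.
have zc : z \in c by move: nc; rewrite (negbTE bc); case: (z \in c).
apply: (finish [:: u; w]) => //.
by rewrite /= adj_sym (PQ _ _ uP (bQ bc)) (PQ _ _ uP wQ) adj_sym PQ ?zP.
Qed.

(** The edges inside [P] and inside [Q] are discarded first, to make the host graph
    bipartite. *)
Lemma drawn_on_complete_between (H G : sgraph) (X : {set H}) k (P Q : {set G}) :
  0 < #|edges H| -> complete_between P Q -> #|P| = side_weight X + k ->
  #|Q| = side_weight (~: X) + k -> @drawn_on H G (P :|: Q).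
Proof.
move=> eH PQ cP cQ.
pose e (u v : G) := adj u v && ((u \in P) != (v \in P)).
have eS : symmetric e by move=> u v; rewrite /e adj_sym eq_sym.
have eI : irreflexive e by move=> u; rewrite /e eqxx andbF.
have dPQ := complete_between_disjoint PQ.
have [||||||b [p dr]] := @drawing_bipartite_ext H (SGraph eS eI) X P eH _ k P Q.
- by move=> u v /andP[].
- exact: subxx.
- by rewrite -disjoints_subset disjoint_sym.
- move=> u v uP vQ; rewrite /adj /= /e PQ //= uP.
  by rewrite (disjointFl dPQ vQ).
- exact: cP.
- exact: cQ.
by exists b, p; apply: drawing_mono dr => u v /andP[].
Qed.

(** * Tileable complete bipartite graphs *)

Definition pair_tileable (G : sgraph) (Pr : {set G} -> Prop) (x y : nat) : Prop :=
  forall P Q : {set G}, complete_between P Q -> #|P| = x -> #|Q| = y ->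
    tiled_by Pr (P :|: Q).

Section PairTileable.
Variables (G : sgraph) (Pr : {set G} -> Prop).

Lemma pair_tileable0 : pair_tileable Pr 0 0.
Proof.
move=> P Q _ /eqP; rewrite cards_eq0 => /eqP -> /eqP; rewrite cards_eq0 => /eqP ->.
by rewrite setU0; exact: tiled_by0.
Qed.

Lemma pair_tileableD x y x' y' : pair_tileable Pr x y -> pair_tileable Pr x' y' ->
  pair_tileable Pr (x + x') (y + y').
Proof.
move=> t t' P Q PQ cP cQ.
have [P1 sP cP1] : exists2 B : {set G}, B \subset P & #|B| = x.
  by apply: exists_subset_card; rewrite cP leq_addr.
have [Q1 sQ cQ1] : exists2 B : {set G}, B \subset Q & #|B| = y.
  by apply: exists_subset_card; rewrite cQ leq_addr.
have dPQ := complete_between_disjoint PQ.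
have -> : P :|: Q = (P1 :|: Q1) :|: ((P :\: P1) :|: (Q :\: Q1)).
  rewrite setUACA; congr (_ :|: _); apply/setP=> u; rewrite !inE.
    by case: (boolP (u \in P1)) => //= /(subsetP sP) ->.
  by case: (boolP (u \in Q1)) => //= /(subsetP sQ) ->.
apply: tiled_byU.
- rewrite disjoints_subset; apply/subsetP=> u; rewrite !inE => /orP[uP|uQ].
    by rewrite uP /= (disjointFr dPQ) ?andbF // (subsetP sP).
  by rewrite uQ /= (disjointFl dPQ) ?andbF ?orbF // (subsetP sQ).
- by apply: t => //; exact: complete_betweenS sP sQ PQ.
- apply: t'; first exact: complete_betweenS (subsetDl _ _) (subsetDl _ _) PQ.
    by rewrite cardsDS // cP cP1 addKn.
  by rewrite cardsDS // cQ cQ1 addKn.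
Qed.

Lemma pair_tileableM k x y : pair_tileable Pr x y -> pair_tileable Pr (k * x) (k * y).
Proof.
by move=> t; elim: k => [|k IH]; [exact: pair_tileable0|rewrite !mulSn; exact: pair_tileableD].
Qed.

End PairTileable.
Arguments pair_tileableM {G Pr} k {x y} _.

Definition bip_tileable (H : sgraph) (x y : nat) : Prop :=
  forall G : sgraph, pair_tileable (@drawn_on H G) x y.

Section BipTileable.
Variable H : sgraph.
Hypothesis eH : 0 < #|edges H|.

Lemma bip_tileable0 : bip_tileable H 0 0.
Proof. by move=> G; exact: pair_tileable0. Qed.

Lemma bip_tileableC x y : bip_tileable H x y -> bip_tileable H y x.
Proof.
by move=> t G P Q /complete_between_sym PQ cP cQ; rewrite setUC; exact: t.
Qed.

Lemma bip_tileableD x y x' y' : bip_tileable H x y -> bip_tileable H x' y' ->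
  bip_tileable H (x + x') (y + y').
Proof. by move=> t t' G; exact: pair_tileableD. Qed.

Lemma bip_tileableM k x y : bip_tileable H x y -> bip_tileable H (k * x) (k * y).
Proof. by move=> t G; exact: pair_tileableM. Qed.

Lemma bip_tileable_split (X : {set H}) k :
  bip_tileable H (side_weight X + k) (side_weight (~: X) + k).
Proof. by move=> G P Q PQ cP cQ; apply/tiled_by1/(drawn_on_complete_between eH PQ cP cQ). Qed.

Arguments bip_tileable_split X k : clear implicits.

(** A subdivision and its mirror image together have sides of equal size. *)
Lemma bip_tileable_balanced (X : {set H}) m :
  side_weight X + side_weight (~: X) <= m -> bip_tileable H m m.
Proof.
move=> le_m; have t1 := bip_tileable_split X (m - (side_weight X + side_weight (~: X))).
have t2 := bip_tileableC (bip_tileable_split X 0).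
have := bip_tileableD t1 t2; congr bip_tileable; lia.
Qed.

Local Open Scope ring_scope.
Import GRing.Theory.

Definition bip_imbalance (z : int) : Prop :=
  exists x y, bip_tileable H x y /\ x%:Z - y%:Z = z.

Lemma bip_imbalanceD z z' : bip_imbalance z -> bip_imbalance z' -> bip_imbalance (z + z').
Proof.
move=> [x [y [t <-]]] [x' [y' [t' <-]]]; exists (x + x')%N, (y + y')%N.
by split; [exact: bip_tileableD|lia].
Qed.

Lemma bip_imbalanceN z : bip_imbalance z -> bip_imbalance (- z).
Proof. by move=> [x [y [t <-]]]; exists y, x; split; [exact: bip_tileableC|lia]. Qed.

Lemma bip_imbalanceM (k z : int) : bip_imbalance z -> bip_imbalance (k * z).
Proof.
move=> zi; have nat_case (n : nat) : bip_imbalance (n%:Z * z).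
  elim: n => [|n IH]; first by rewrite mul0r; exists 0%N, 0%N; split=> //; exact: bip_tileable0.
  by rewrite intS mulrDl mul1r; exact: bip_imbalanceD.
case: k => n; first exact: nat_case.
by rewrite NegzE mulNr; exact/bip_imbalanceN/nat_case.
Qed.

Lemma bip_imbalance_gcd (l : seq int) : (forall c, c \in l -> bip_imbalance c) ->
  bip_imbalance (\big[gcdn/0%N]_(c <- l) `|c|%N)%:Z.
Proof.
elim: l => [|c l IH] Hl.
  by rewrite big_nil; exists 0%N, 0%N; split=> //; exact: bip_tileable0.
rewrite big_cons; set g := \big[gcdn/0%N]_(_ <- l) _.
have ig : bip_imbalance g%:Z by apply: IH => c' c'l; apply: Hl; rewrite inE c'l orbT.
have ic : bip_imbalance c by apply: Hl; rewrite inE eqxx.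
have [u [v]] := Bezoutz c g%:Z; rewrite /gcdz absz_nat => <-.
by apply: bip_imbalanceD; exact: bip_imbalanceM.
Qed.

(** Imbalances are closed under addition, by disjoint union, and under opposite, by
    exchanging the sides.  So they form a subgroup of the integers, which contains
    the gcd of [C_xi H]. *)
Lemma bip_imbalance_all : hcf_xi H = Some 1%N -> forall z, bip_imbalance z.
Proof.
rewrite /hcf_xi; case: ifP => // _ [g1] z; rewrite -[z]mulr1.
apply: bip_imbalanceM; rewrite -[1]/(1%N%:Z) -g1; apply: bip_imbalance_gcd => c.
case/mapP => X _ ->; exists (side_weight X), (side_weight (~: X)).
split; first by have := bip_tileable_split X 0; rewrite !addn0.
by rewrite /side_weight setCK.
Qed.

Local Close Scope ring_scope.

(** The imbalance [x - y] is met, up to a multiple of [a - b], by one of finitely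
    many tileable pairs; copies of the most unbalanced subdivision account for that
    multiple, and what is left is balanced. *)
Lemma bip_tileable_interior (X : {set H}) :
  hcf_xi H = Some 1 -> side_weight (~: X) < side_weight X ->
  exists C, forall x y, side_weight (~: X) * x + C <= side_weight X * y ->
    side_weight (~: X) * y + C <= side_weight X * x -> bip_tileable H x y.
Proof.
set a := side_weight X; set b := side_weight (~: X) => hcf1 ba.
have [Y HY] : exists Y, forall i, i < a - b ->
    exists2 y, y <= Y & bip_tileable H (y + i) y.
  elim: (a - b) => [|d [Y HY]]; first by exists 0.
  have [x [y [t xy]]] := bip_imbalance_all hcf1 d%:Z.
  exists (Y + y) => i; rewrite ltnS leq_eqVlt => /predU1P[->|/HY[y' le_y' t']].
    exists y; first exact: leq_addl.
    by move: t; congr bip_tileable; lia.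
  by exists y' => //; apply: leq_trans le_y' (leq_addr _ _).
exists ((a - b) * (Y + a + b)) => x y.
wlog le_yx : x y / y <= x => [hw|] H1 H2.
  by case: (leqP y x) => [yx|/ltnW xy]; [exact: hw|apply: bip_tileableC; exact: hw].
set D := a - b in HY H1 H2 *; have D0 : 0 < D by rewrite subn_gt0.
pose k := (x - y) %/ D; pose i := (x - y) %% D.
have xy : x - y = k * D + i by exact: divn_eq.
have [yi le_yi ti] : exists2 yi, yi <= Y & bip_tileable H (yi + i) yi.
  by apply: HY; rewrite ltn_mod.
have le_y : b * k + (Y + a + b) <= y.
  rewrite -(leq_pmul2l D0) mulnDr; rewrite {2}/D mulnBl.
  have : b * (k * D) <= b * (x - y) by rewrite xy leq_mul2l leq_addr orbT.
  rewrite mulnBr; nia.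
pose z := y - (yi + k * b).
have tz : bip_tileable H z z by apply: (@bip_tileable_balanced X); rewrite -/a -/b /z; lia.
have tk := @bip_tileableM k _ _ (bip_tileable_split X 0).
rewrite !addn0 -/a -/b in tk.
have := bip_tileableD (bip_tileableD ti tk) tz.
have aD : a = b + D by rewrite /D subnKC // ltnW.
congr bip_tileable; rewrite /z; last lia.
have -> : k * a = k * b + k * D by rewrite aD mulnDr.
by move: xy le_y le_yi le_yx; rewrite (mulnC b k); lia.
Qed.

End BipTileable.

(** * Tilings covering almost all vertices *)

Definition nbrs (G : sgraph) (u : G) : {set G} := [set v | adj u v].

Section AlmostCover.
Variables A B g e : nat.
Hypotheses (B0 : 0 < B) (BA : B < A) (g0 : 0 < g) (e0 : 0 < e).
Let S := A + B.
(* The ratio between the scales of the tiles of two successive rounds. *)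
Let M := 4 * g * S.

(** Minimum degree at least [(B / (A + B) + 1 / g) * #|G|]. *)
Definition dense_graph (G : sgraph) : Prop :=
  forall u : G, #|G| * (B * g + S) <= g * S * #|nbrs u|.

Definition is_tile (G : sgraph) (t : nat) (W : {set G}) : Prop :=
  exists P Q, [/\ complete_between P Q, W = P :|: Q &
    (#|P| = t /\ #|Q| = t) \/ (#|P| = B * t /\ #|Q| = A * t)].

(** Double counting the adjacencies between [U] and the pieces of [D] finds a piece
    in which many vertices of [U] have more than the average share of neighbours;
    as pieces have bounded size, many of those vertices even have the same
    neighbours there. *)
Lemma popular_neighbourhood (G : sgraph) (D : {set {set G}}) (W U : {set G}) m K :
  dense_graph G -> partition D W -> 2 * g * #|~: W| <= #|G| ->
  (forall Z, Z \in D -> #|Z| <= m) -> 0 < K -> 4 * g * 2 ^ m * K <= #|U| ->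
  exists Z N U' : {set G}, [/\ Z \in D, N \subset Z, U' \subset U /\ K <= #|U'|,
    (4 * g * B + S) * #|Z| <= 4 * g * S * #|N| & complete_between N U'].
Proof.
move=> dG pD cW Dm K0 KU.
have U0 : 0 < #|U| by apply: leq_trans KU; rewrite !muln_gt0 g0 expn_gt0.
pose good (Z : {set G}) (u : G) := (4 * g * B + S) * #|Z| <= 4 * g * S * #|nbrs u :&: Z|.
pose UZ (Z : {set G}) := [set u in U | good Z u].
have sumN u := sum_card_capI (nbrs u) pD.
have sumD : \sum_(Z in D) #|Z| = #|W| by rewrite (card_partition pD).
have G0 : 0 < #|G| by apply: leq_trans U0 (max_card _).
have many u : #|G| * (4 * B * g + 2 * S) <= 4 * g * S * #|nbrs u :&: W|.
  have := dG u; rewrite -(cardsID W (nbrs u)) => H.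
  have : #|nbrs u :\: W| <= #|~: W|.
    by apply: subset_leq_card; rewrite setDE subsetIr.
  move: cW H; nia.
have [Z ZD HZ] : exists2 Z, Z \in D & #|U| <= 4 * g * #|UZ Z|.
  apply/exists_inP; apply: contraT => /exists_inPn noZ.
  have ltZ Z : Z \in D -> 4 * g * #|UZ Z| < #|U| by move=> ZD; rewrite ltnNge noZ.
  have ltZ' : 4 * g * \sum_(Z in D) #|UZ Z| * #|Z| <= #|U|.-1 * #|W|.
    rewrite -sumD !big_distrr /=; apply: leq_sum => Z /ltZ ltZ1.
    by rewrite mulnA leq_mul2r -ltnS prednK // ltZ1 orbT.
  have up Z : \sum_(u in U) 4 * g * S * #|nbrs u :&: Z| <=
      #|U| * ((4 * g * B + S) * #|Z|) + #|UZ Z| * (4 * g * S * #|Z|).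
    rewrite -sum_nat_const -[#|UZ Z|]sum1_card big_distrl /=.
    rewrite [X in _ <= _ + X](eq_bigl (fun u => (u \in U) && good Z u)); last first.
      by move=> u; rewrite inE.
    rewrite big_mkcondr /= -big_split /=; apply: leq_sum => u uU.
    case: ifP => [_|/negbT]; last by rewrite addn0 -ltnNge => /ltnW.
    rewrite mul1n; apply: leq_trans (leq_addl _ _).
    by rewrite leq_mul2l subset_leq_card ?orbT // subsetIr.
  have low : #|U| * (#|G| * (4 * B * g + 2 * S)) <=
      \sum_(u in U) \sum_(Z in D) 4 * g * S * #|nbrs u :&: Z|.
    rewrite -sum_nat_const; apply: leq_sum => u _.
    by rewrite -big_distrr /= sumN.
  have [u uU] : exists u, u \in U by apply/card_gt0P.
  have : #|U| * (#|G| * (4 * B * g + 2 * S)) <=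
      #|U| * ((4 * g * B + S) * #|W|) + S * (4 * g * \sum_(Z in D) #|UZ Z| * #|Z|).
    refine (leq_trans low _). rewrite exchange_big /=.
    apply: (leq_trans (leq_sum _ (fun Z _ => up Z))); rewrite big_split /=.
    rewrite -!big_distrr /= sumD leq_add2l mulnA !big_distrr /= leq_sum // => Z _.
    by rewrite mulnCA (mulnC S) -!mulnA.
  have leW : #|W| <= #|G| by exact: max_card.
  have S0 : 0 < S by rewrite addn_gt0 B0 orbT.
  move: ltZ'; set X := 4 * g * _; move=> HX.
  have : S * X <= S * (#|U|.-1 * #|W|) by rewrite leq_mul2l HX orbT.
  have : #|U|.-1 * #|W| < #|U| * #|G|.
    rewrite (leq_ltn_trans (_ : _ <= #|U|.-1 * #|G|)) ?leq_mul2l ?leW ?orbT //.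
    by rewrite ltn_mul2r G0 prednK // leqnn.
  rewrite -(ltn_pmul2l S0); set Y := _ * #|W| => HY1 HY2 HY3.
  have : #|U| * ((4 * g * B + S) * #|W|) <= #|U| * ((4 * g * B + S) * #|G|).
    by rewrite !leq_mul2l leW !orbT.
  move: HY1 HY2 HY3; set y := S * Y; set x := S * X.
  set z := #|U| * (_ * #|W|) => HY1 HY2 HY3 HY4.
  have : #|U| * (#|G| * (4 * B * g + 2 * S)) = 
     #|U| * ((4 * g * B + S) * #|G|) + S * (#|U| * #|G|) by nia.
  lia.
have UZ0 : 0 < #|UZ Z| by rewrite lt0n; apply: contraTneq HZ => ->; rewrite muln0 -ltnNge.
have powZ u : u \in UZ Z -> nbrs u :&: Z \in powerset Z by rewrite powersetE subsetIr.
have [N] := pigeonhole_fiber UZ0 powZ; rewrite powersetE card_powerset => NZ HN.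
set U' := [set u in UZ Z | _] in HN.
have [u] : exists u, u \in U'.
  by apply/card_gt0P; rewrite lt0n; apply: contraTneq HN => ->; rewrite muln0 -ltnNge.
rewrite !inE => /andP[/andP[uU gu] /eqP eN].
exists Z, N, U'; split=> //.
- split; first by apply/subsetP=> w; rewrite !inE => /andP[/andP[]].
  have : 2 ^ #|Z| <= 2 ^ m by rewrite leq_exp2l // Dm.
  move: KU HZ HN; set p := 2 ^ m; set q := 2 ^ #|Z| => KU HZ HN qp.
  have p0 : 0 < p by rewrite expn_gt0.
  have H1 : 4 * g * p * K <= 4 * g * p * #|U'|.
    apply: (leq_trans KU); apply: (leq_trans HZ); rewrite -!mulnA !leq_mul2l /=.
    by rewrite (leq_trans HN) ?orbT // leq_mul2r qp orbT.
  by move: H1; rewrite leq_pmul2l // !muln_gt0 g0 p0.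
- by rewrite -eN.
- move=> v w vN; rewrite !inE => /andP[_ /eqP eNw]; move: vN; rewrite -eNw !inE.
  by case/andP; rewrite adj_sym.
Qed.

Lemma tile_pair (G : sgraph) t x y :
  @pair_tileable G (is_tile t) ((x * B + y) * t) ((x * A + y) * t).
Proof.
have tE : @pair_tileable G (is_tile t) (x * (B * t)) (x * (A * t)).
  by apply: pair_tileableM => P Q PQ cP cQ; apply: tiled_by1; exists P, Q; split=> //; right.
have tB : @pair_tileable G (is_tile t) (y * t) (y * t).
  by apply: pair_tileableM => P Q PQ cP cQ; apply: tiled_by1; exists P, Q; split=> //; left.
by have := pair_tileableD tE tB; rewrite !mulnA -!mulnDl.
Qed.

Lemma tile_split (G : sgraph) t k (Z : {set G}) :
  is_tile (k * t) Z -> tiled_by (is_tile t) Z.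
Proof.
case=> P [Q [PQ -> [[cP cQ]|[cP cQ]]]].
  by apply: (@tile_pair G t 0 k) => //; rewrite mul0n.
by apply: (@tile_pair G t k 0) => //; rewrite addn0 mulnAC ?cP ?cQ -?mulnA mulnC ?mulnA // mulnC.
Qed.

Lemma tile_card (G : sgraph) t (Z : {set G}) : is_tile t Z -> #|Z| <= S * t.
Proof.
case=> P [Q [PQ -> c]]; apply: leq_trans (leq_card_setU _ _).1 _.
by rewrite /S; case: c => -[-> ->]; nia.
Qed.

(** From a balanced tile, one unbalanced small tile is cut out with part of its large
    side in [U'].  In an unbalanced tile, [N] is larger than the small side, so it
    meets the large side; the vertices met there are paired with vertices of [U'],
    which makes the rest of the tile less unbalanced. *)
Lemma tile_refine (G : sgraph) t (Z N U' : {set G}) :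
  is_tile (M * t) Z -> N \subset Z -> complete_between N U' ->
  [disjoint Z & U'] -> A * t <= #|U'| ->
  (4 * g * B + S) * #|Z| <= 4 * g * S * #|N| ->
  exists U'' : {set G}, [/\ U'' \subset U', #|U''| = (A - B) * t &
    tiled_by (is_tile t) (Z :|: U'')].
Proof.
move=> [P [Q [PQ eZ c]]] sN NU dZ cU cN; subst Z.
have dPQ := complete_between_disjoint PQ.
have cardPQ : #|P :|: Q| = #|P| + #|Q|.
  by move: dPQ; rewrite -leq_card_setU => /eqP.
have [U'' sU cU''] : exists2 X : {set G}, X \subset U' & #|X| = (A - B) * t.
  apply: exists_subset_card; apply: leq_trans cU; rewrite leq_mul2r leq_subr orbT //.
exists U''; split=> //.
have NU'' := complete_betweenS (subxx N) sU NU.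
have leN : #|N| <= #|N :&: P| + #|N :&: Q|.
  apply: leq_trans (leq_card_setU _ _).1; rewrite -setIUr.
  by apply: subset_leq_card; rewrite subsetI subxx.
have dU v : v \in U'' -> v \notin P /\ v \notin Q.
  move=> /(subsetP sU) vU; have := disjointFl dZ vU.
  by rewrite inE => /norP.
have balanced P1 Q1 : complete_between P1 Q1 -> #|P1| = M * t -> #|Q1| = M * t ->
    P :|: Q = P1 :|: Q1 -> B * t <= #|N :&: P1| -> tiled_by (is_tile t) (P :|: Q :|: U'').
  move=> PQ1 cP1 cQ1 eZ NP.
  have [P' sP' cP'] := exists_subset_card NP.
  have [Q' sQ' cQ'] : exists2 X : {set G}, X \subset Q1 & #|X| = B * t.
    by apply: exists_subset_card; rewrite cQ1 leq_mul2r /M /S; apply/orP; right; nia.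
  have sP'N : P' \subset N by apply: subset_trans sP' (subsetIl _ _).
  have sP'P : P' \subset P1 by apply: subset_trans sP' (subsetIr _ _).
  have dPQ1 := complete_between_disjoint PQ1.
  have dU1 v : v \in U'' -> v \notin P1 /\ v \notin Q1.
    by move=> /dU[vP vQ]; apply/norP; rewrite -in_setU -eZ inE negb_or vP.
  have -> : P :|: Q :|: U'' = (P' :|: (Q' :|: U'')) :|: ((P1 :\: P') :|: (Q1 :\: Q')).
    rewrite eZ; apply/setP=> u; rewrite !inE.
    case: (boolP (u \in P')) => [/(subsetP sP'P) ->|_] //=.
    case: (boolP (u \in Q')) => [/(subsetP sQ') ->|_] //=; first by rewrite orbT.
    by rewrite [RHS]orbC.
  apply: tiled_byU.
  - rewrite disjoints_subset; apply/subsetP=> u; rewrite !inE => /or3P[uP|uQ|uU].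
    + by rewrite uP /= (disjointFr dPQ1) ?andbF // (subsetP sP'P).
    + by rewrite uQ /= (disjointFl dPQ1) ?andbF // (subsetP sQ').
    + by have [/negbTE-> /negbTE->] := dU1 _ uU; rewrite !andbF.
  - apply: tiled_by1; exists P', (Q' :|: U''); split=> //.
      apply: complete_betweenU; first exact: complete_betweenS sP'P sQ' PQ1.
      exact: complete_betweenS sP'N (subxx _) NU''.
    right; split=> //; rewrite (eqP (_ : #|Q' :|: U''| == #|Q'| + #|U''|)).
      by rewrite cQ' cU'' -mulnDl subnKC // ltnW.
    rewrite leq_card_setU disjoint_sym disjoints_subset; apply/subsetP=> v.
    by move=> /dU1[_ vQ]; rewrite inE; apply: contra vQ; exact: (subsetP sQ').
  - apply: (@tile_pair G t 0 (M - B)); last 2 first.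
    + by rewrite mul0n add0n cardsDS // cP1 cP' mulnBl.
    + by rewrite mul0n add0n cardsDS // cQ1 cQ' mulnBl.
    exact: complete_betweenS (subsetDl _ _) (subsetDl _ _) PQ1.
case: c => -[cP cQ].
  have : 2 * (B * t) <= #|N :&: P| + #|N :&: Q|.
    have S0 : 0 < 4 * g * S by rewrite !muln_gt0 g0 addn_gt0 B0 orbT.
    apply: leq_trans leN; rewrite -(leq_pmul2l S0); apply: leq_trans cN.
    rewrite cardPQ cP cQ /M; nia.
  case: (leqP (B * t) #|N :&: P|) => [NP _|ltP NQ].
    exact: (balanced P Q).
  apply: (balanced Q P) => //; [exact: complete_between_sym|exact: setUC|lia].
have NQ : (A - B) * t <= #|N :&: Q|.
  have : #|N :&: P| <= B * (M * t) by rewrite -cP subset_leq_card // subsetIr.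
  have : 4 * g * S * #|N| <= 4 * g * S * (#|N :&: P| + #|N :&: Q|) by rewrite leq_mul2l leN orbT.
  move: cN; rewrite cardPQ cP cQ -mulnDl (addnC B) -/S.
  rewrite -/M; set x := #|N|; set p := #|_ :&: P|; set q := #|_ :&: Q| => h1 h2 h3.
  have S0 : 0 < S by rewrite addn_gt0 B0 orbT.
  have M0 : 0 < M by rewrite !muln_gt0 g0.
  have h4 : (4 * g * B + S) * (S * (M * t)) = M * (B * (M * t)) + M * (S * S * t).
    by rewrite {2}/M; nia.
  have h5 : M * (B * (M * t)) + M * (S * S * t) <= M * (p + q).
    by rewrite -h4; apply: leq_trans h1 h2.
  rewrite -mulnDr leq_pmul2l // in h5.
  have : S * S * t <= q by lia.
  apply: leq_trans; rewrite leq_mul2r; apply/orP; right; rewrite /S; nia.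
have [Q' sQ' cQ'] := exists_subset_card NQ.
have sQ'N : Q' \subset N by apply: subset_trans sQ' (subsetIl _ _).
have sQ'Q : Q' \subset Q by apply: subset_trans sQ' (subsetIr _ _).
have -> : P :|: Q :|: U'' = (Q' :|: U'') :|: (P :|: (Q :\: Q')).
  apply/setP=> u; rewrite !inE.
  case: (boolP (u \in Q')) => [/(subsetP sQ'Q) ->|_] /=; first by rewrite orbT.
  by rewrite [RHS]orbC.
apply: tiled_byU.
- rewrite disjoints_subset; apply/subsetP=> u; rewrite !inE => /orP[uQ|uU].
    by rewrite uQ /= orbF (disjointFl dPQ) // (subsetP sQ'Q).
  by have [/negbTE-> /negbTE->] := dU _ uU; rewrite !andbF.
- apply: (@tile_pair G t 0 (A - B)); rewrite ?mul0n ?add0n //.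
  exact: complete_betweenS sQ'N (subxx _) NU''.
- have M0 : 0 < M by rewrite !muln_gt0 g0 addn_gt0 B0 orbT.
  apply: (@tile_pair G t M.-1 B).
  + exact: complete_betweenS (subxx _) (subsetDl _ _) PQ.
  + by rewrite cP mulnA; congr (_ * _); rewrite -{1}(prednK M0); lia.
  + rewrite cardsDS // cQ cQ' mulnA -mulnBl; congr (_ * _).
    rewrite -{1}(prednK M0); nia.
Qed.

Let S0 : 0 < S. Proof. by rewrite addn_gt0 B0 orbT. Qed.
Let M0 : 0 < M. Proof. by rewrite !muln_gt0 g0. Qed.

(** One improvement.  The uncovered set [U] is cut into chunks, so that the popular
    piece is either a large tile, which is then refined, or a chunk, where a
    balanced tile is found inside [U] itself. *)
Lemma cover_step (G : sgraph) t (W1 W2 : {set G}) :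
  dense_graph G -> 0 < t ->
  tiled_by (is_tile (M * t)) W1 -> tiled_by (is_tile t) W2 -> [disjoint W1 & W2] ->
  4 * g * #|W2| <= #|G| -> 4 * g * (S * t) <= #|G| ->
  e * (4 * g * 2 ^ (S * (M * t)) * (A * t)) <= #|G| ->
  #|G| < e * #|~: (W1 :|: W2)| ->
  exists W1' W2' : {set G},
    [/\ tiled_by (is_tile (M * t)) W1', tiled_by (is_tile t) W2', [disjoint W1' & W2'],
        #|W1 :|: W2| + t <= #|W1' :|: W2'| & #|W2'| <= #|W2| + 2 * (S * (M * t))].
Proof.
move=> dG t0 [D1 [pD1 tD1]] tW2 d12 cW2 cG1 cG2; set U := ~: _ => cU.
have St0 : 0 < S * t by rewrite muln_gt0 S0.
have [U0 sU0 [[D0 [pD0 tD0]] ltU0]] := chunk_cover U St0.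
have dWU : [disjoint W1 & U0].
  rewrite disjoint_sym disjoints_subset (subset_trans sU0) // /U setCU subsetIl //.
have d2U : [disjoint W2 & U].
  by rewrite disjoints_subset /U setCK subsetUr.
have AB0 : t <= (A - B) * t by rewrite leq_pmull // subn_gt0.
have pD : partition (D1 :|: D0) (W1 :|: U0).
  have [/and3P[/eqP c1 tr1 n1] /and3P[/eqP c0 tr0 n0]] := (pD1, pD0).
  apply/and3P; split.
  - by rewrite /cover bigcup_setU -/(cover D1) -/(cover D0) c1 c0.
  - apply/trivIsetP=> C1 C2; rewrite !inE => /orP[C11|C10] /orP[C21|C20] ne.
    + exact: (trivIsetP tr1).
    + apply: disjointWl (disjointWr _ dWU); first by rewrite -c1; apply: bigcup_sup C11.
      by rewrite -c0; apply: bigcup_sup C20.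
    + rewrite disjoint_sym.
      apply: disjointWl (disjointWr _ dWU); first by rewrite -c1; apply: bigcup_sup C21.
      by rewrite -c0; apply: bigcup_sup C10.
    + exact: (trivIsetP tr0).
  - by rewrite inE negb_or n1.
have cC : 2 * g * #|~: (W1 :|: U0)| <= #|G|.
  have : #|~: (W1 :|: U0)| <= #|W2| + #|U :\: U0|.
    apply: leq_trans (leq_card_setU _ _).1; apply: subset_leq_card; apply/subsetP=> v.
    rewrite /U !inE negb_or => /andP[v1 ->]; rewrite (negbTE v1) /=.
    by case: (v \in W2).
  move=> le_c; rewrite -(@leq_pmul2l 2) // mulnA mulnA (mul2n #|G|) -addnn.
  apply: (@leq_trans (4 * g * (#|W2| + #|U :\: U0|))); first by rewrite leq_mul2l le_c orbT.
  rewrite mulnDr leq_add //; apply: leq_trans cG1; rewrite leq_mul2l; apply/orP; right.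
  exact: ltnW.
have cards Z : Z \in D1 :|: D0 -> #|Z| <= S * (M * t).
  rewrite in_setU => /orP[/tD1|/tD0 ->]; first exact: tile_card.
  by rewrite leq_mul2l leq_pmull ?orbT.
have K0 : 0 < A * t by rewrite muln_gt0 t0 andbT (leq_ltn_trans _ BA).
have cU' : 4 * g * 2 ^ (S * (M * t)) * (A * t) <= #|U|.
  by rewrite -(leq_pmul2l e0) (leq_trans cG2) // ltnW.
have [Z [N [U' [ZD sN [sU' cU1] cN NU]]]] :=
  popular_neighbourhood dG pD cC cards K0 cU'.
have small2 : (A + B) * t <= S * (M * t) by rewrite -/S leq_mul2l leq_pmull ?orbT.
move: ZD; rewrite in_setU => /orP[ZD1|ZD0]; last first.
  have NZ : t <= #|N|.
    move: cN; rewrite tD0 // => cN.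
    have S4 : 0 < 4 * g * S by rewrite !muln_gt0 g0.
    rewrite -(leq_pmul2l S4); apply: leq_trans cN.
    rewrite -mulnA leq_mul // (leq_trans _ (leq_addr _ _)) // leq_pmulr //.
  have U't : t <= #|U'|.
    by apply: leq_trans cU1; rewrite leq_pmull // (leq_ltn_trans _ BA).
  have [N1 sN1 cN1] := exists_subset_card NZ.
  have [U1 sU1 cU1'] := exists_subset_card U't.
  have NU1 := complete_betweenS sN1 sU1 NU.
  have cNU := cardsU_disjoint (complete_between_disjoint NU1).
  have sNU : N1 :|: U1 \subset U.
    rewrite subUset (subset_trans sU1) // andbT (subset_trans sN1) // (subset_trans sN) //.
    apply: subset_trans sU0; case/and3P: pD0 => /eqP <- _ _; exact: bigcup_sup ZD0.
  have dNU2 : [disjoint W2 & N1 :|: U1] := disjointWr sNU d2U.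
  have d1U : [disjoint W1 & N1 :|: U1].
    by apply: disjointWr sNU _; rewrite disjoints_subset /U setCK subsetUl.
  exists W1, (W2 :|: (N1 :|: U1)); split.
  - by exists D1.
  - apply: tiled_byU => //; apply: tiled_by1; exists N1, U1; split=> //; left; split=> //.
  - by rewrite disjointUr.
  - rewrite setUA [X in _ <= X]cardsU_disjoint; last by rewrite disjointUl.
    by rewrite leq_add2l cNU cN1 leq_addr.
  - rewrite cardsU_disjoint // leq_add2l cNU cN1 cU1' addnn -mul2n leq_mul2l /=.
    by apply: leq_trans small2; rewrite -/S leq_pmull.
have sZW : Z \subset W1 by case/and3P: pD1 => /eqP <- _ _; exact: bigcup_sup ZD1.
have dZU : [disjoint Z & U'].
  apply: disjointWl sZW (disjointWr sU' _).
  by rewrite disjoints_subset /U setCK subsetUl.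
have [U'' [sU'' cU'' tZ]] := tile_refine (tD1 _ ZD1) sN NU dZU cU1 cN.
have [eW1 dZR pR] := partitionD1_piece pD1 ZD1.
set R := cover (D1 :\ Z) in eW1 dZR pR.
have dZ2 : [disjoint Z & W2] := disjointWl sZW d12.
have sRW : R \subset W1 by rewrite eW1 subsetUr.
have dR2 : [disjoint R & W2] := disjointWl sRW d12.
have sU2 : U'' \subset U := subset_trans sU'' sU'.
have d1U : [disjoint W1 & U''].
  by apply: disjointWr sU2 _; rewrite disjoints_subset /U setCK subsetUl.
have dRU : [disjoint R & U''] := disjointWl sRW d1U.
have d2U'' : [disjoint W2 & U''] := disjointWr sU2 d2U.
have dZU'' : [disjoint Z & U''] := disjointWl sZW d1U.
exists R, (W2 :|: (Z :|: U'')); split.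
- by exists (D1 :\ Z); split=> // X; rewrite inE => /andP[_ /tD1].
- by apply: tiled_byU => //; rewrite disjointUr // disjoint_sym.
- by rewrite !disjointUr // disjoint_sym.
- have -> : R :|: (W2 :|: (Z :|: U'')) = (W1 :|: W2) :|: U''.
    by rewrite eW1 [RHS]setUAC setUA setUA (setUC (_ :|: _) Z) !setUA (setUAC _ W2).
  rewrite [X in _ <= X]cardsU_disjoint; last by rewrite disjointUl.
  by rewrite leq_add2l cU''.
- rewrite cardsU_disjoint; last by rewrite disjointUr // disjoint_sym.
  rewrite leq_add2l cardsU_disjoint // cU'' mul2n -addnn leq_add //.
    exact/tile_card/tD1.
  by apply: leq_trans small2; rewrite leq_mul2r (leq_trans (leq_subr _ _) (leq_addr _ _)) orbT.
Qed.

(** Each step gains at least [t] vertices and affects at most a constant multiple of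
    [t], so a number of steps of order [#|G| / t] is possible before the small
    tiles [W2] take up too much of the neighbourhoods.  This gains a positive
    proportion of the vertices, which does not depend on [t]. *)
Lemma cover_round (G : sgraph) t (W : {set G}) :
  dense_graph G -> 0 < t -> tiled_by (is_tile (M * t)) W ->
  4 * g * (S * t) <= #|G| ->
  e * (4 * g * 2 ^ (S * (M * t)) * (A * t)) <= #|G| ->
  16 * g * (S * M * t) <= #|G| ->
  exists W' : {set G}, tiled_by (is_tile t) W' /\
    (e * #|~: W'| <= #|G| \/ 16 * g * S * M * #|W| + #|G| <= 16 * g * S * M * #|W'|).
Proof.
move=> dG t0 tW cG1 cG2 cG3; pose K := 2 * (S * (M * t)).
have join (W1 W2 : {set G}) : tiled_by (is_tile (M * t)) W1 -> tiled_by (is_tile t) W2 ->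
    [disjoint W1 & W2] -> tiled_by (is_tile t) (W1 :|: W2).
  move=> t1 t2 d; apply: tiled_byU => //; apply: tiled_by_refine t1 => Z.
  exact: tile_split.
have rounds j : j * (4 * g * K) <= #|G| ->
    (exists W' : {set G}, tiled_by (is_tile t) W' /\ e * #|~: W'| <= #|G|) \/
    exists W1 W2 : {set G}, [/\ tiled_by (is_tile (M * t)) W1, tiled_by (is_tile t) W2,
      [disjoint W1 & W2], #|W| + j * t <= #|W1 :|: W2| & #|W2| <= j * K].
  elim: j => [|j IH] le_j.
    right; exists W, set0; rewrite setU0 addn0 cards0; split=> //; first exact: tiled_by0.
    by rewrite disjoint_sym disjoints_subset sub0set.
  have le_j' : j * (4 * g * K) <= #|G| by apply: leq_trans le_j; rewrite leq_mul2r leqnSn orbT.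
  have [|[W1 [W2 [t1 t2 d12 c12 c2]]]] := IH le_j'; first by left.
  have [small|big] := leqP (e * #|~: (W1 :|: W2)|) #|G|.
    by left; exists (W1 :|: W2); split=> //; exact: join.
  have cW2 : 4 * g * #|W2| <= #|G|.
    by apply: leq_trans le_j'; rewrite mulnCA leq_mul2l c2 orbT.
  have [W1' [W2' [t1' t2' d' c' c2']]] := cover_step dG t0 t1 t2 d12 cW2 cG1 cG2 big.
  right; exists W1', W2'; split=> //.
    by apply: leq_trans c'; rewrite mulSn (addnC t) addnA leq_add2r.
  by apply: leq_trans c2' _; rewrite mulSn addnC leq_add2l.
have K0 : 0 < 4 * g * K by rewrite /K !muln_gt0 ?g0 ?S0 ?t0.
have [[W' [tW' cW']]|[W1 [W2 [t1 t2 d12 c12 _]]]] := rounds _ (leq_trunc_div #|G| (4 * g * K)).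
  by exists W'; split=> //; left.
exists (W1 :|: W2); split; first exact: join.
right; apply: (@leq_trans (16 * g * S * M * (#|W| + #|G| %/ (4 * g * K) * t))); last first.
  by rewrite leq_mul2l c12 orbT.
rewrite mulnDr leq_add2l; move: cG3; have := ltn_ceil #|G| K0.
set q := #|G| %/ _.
have -> : 16 * g * S * M * (q * t) = 2 * (q * (4 * g * K)) by rewrite /K; clear; lia.
have -> : 16 * g * (S * M * t) = 2 * (4 * g * K) by rewrite /K; clear; lia.
rewrite mulSn; set X := q * _; set Y := 4 * g * K; move: #|G| X Y; clear; lia.
Qed.

(** As the gain of a round does not depend on the scale of the tiles, a bounded number
    of rounds suffices, each with tiles [M] times smaller than those of the round
    before. *)
Lemma almost_cover t : 0 < t -> exists n0, forall G : sgraph, n0 <= #|G| ->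
  dense_graph G -> exists W : {set G}, tiled_by (is_tile t) W /\ e * #|~: W| <= #|G|.
Proof.
move=> t0; pose D := 16 * g * S * M.
have rounds j : forall t, 0 < t -> exists n0, forall G : sgraph, n0 <= #|G| ->
    dense_graph G -> exists W : {set G}, tiled_by (is_tile t) W /\
      (e * #|~: W| <= #|G| \/ j * #|G| <= D * #|W|).
  elim: j => [|j IH] {t0}t t0.
    exists 0 => G _ _; exists set0; split; first exact: tiled_by0.
    by right.
  have Mt0 : 0 < M * t by rewrite muln_gt0 M0.
  have [n1 Hn1] := IH _ Mt0.
  exists (n1 + (4 * g * (S * t) + (e * (4 * g * 2 ^ (S * (M * t)) * (A * t)) +
    16 * g * (S * M * t)))) => G.
  set c1 := 4 * g * (S * t); set c2 := e * _; set c3 := 16 * g * (S * M * t) => leG dG.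
  have [l0 l1 l2 l3] : [/\ n1 <= #|G|, c1 <= #|G|, c2 <= #|G| & c3 <= #|G|].
    move: {Hn1} n1 c1 c2 c3 #|G| leG => a b c d n Hn; split; clear -Hn; lia.
  have [W [tW [cW|cW]]] := Hn1 G l0 dG.
    exists W; split; last by left.
    by apply: tiled_by_refine tW => Z; exact: tile_split.
  have [W' [tW' [cW'|cW']]] := cover_round dG t0 tW l1 l2 l3.
    by exists W'; split=> //; left.
  exists W'; split=> //; right; rewrite -/D in cW'.
  by apply: leq_trans cW'; rewrite mulSn addnC leq_add2r.
have [n0 Hn0] := rounds D.+1 t t0; exists n0.+1 => G leG dG.
have [W [tW [cW|cW]]] := Hn0 G (ltnW leG) dG; first by exists W.
have : D.+1 * #|G| <= D * #|G| by apply: leq_trans cW _; rewrite leq_mul2l max_card orbT.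
by rewrite mulSn -{2}[D * _]add0n leq_add2r leqn0 => /eqP G0; rewrite G0 in leG.
Qed.

End AlmostCover.

(** * Absorbing the uncovered vertices *)

Section Absorb.
Variables (H : sgraph) (a b C m : nat).
Hypotheses (a0 : 0 < a) (m0 : 0 < m).
Hypothesis interior : forall x y, b * x + C <= a * y -> b * y + C <= a * x ->
  bip_tileable H x y.
Hypothesis balanced : bip_tileable H m m.

(** A vertex [v] with [m] neighbours on one side, these neighbours and [m.-1]
    vertices of the other side span a balanced complete bipartite graph.  Removing
    such graphs one by one leaves a complete bipartite graph in the tileable
    range. *)
Lemma absorb_pair (G : sgraph) k (V P Q : {set G}) :
  #|V| = k -> complete_between P Q -> [disjoint V & P :|: Q] ->
  (forall v, v \in V -> m * k <= #|nbrs v :&: P| \/ m * k <= #|nbrs v :&: Q|) ->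
  b * #|Q| + C + a * m * k <= a * #|P| -> b * #|P| + C + a * m * k <= a * #|Q| ->
  tiled_by (@drawn_on H G) (P :|: Q :|: V).
Proof.
elim: k V P Q => [|k IHk] V P Q cV PQ dV nV hP hQ.
  move/eqP: cV; rewrite cards_eq0 => /eqP ->; rewrite setU0.
  by rewrite muln0 !addn0 in hP hQ; exact: (interior hQ hP PQ erefl erefl).
have [v vV] : exists v, v \in V by apply/card_gt0P; rewrite cV.
wlog vP : P Q PQ dV nV hP hQ / m * k.+1 <= #|nbrs v :&: P|.
  move=> hw; case: (nV v vV) => [|vQ]; first exact: hw.
  rewrite (setUC P); apply: hw => //; first exact: complete_between_sym.
    by rewrite setUC.
  by move=> w /nV[]; [right|left].
have [P' sP' cP'] : exists2 X : {set G}, X \subset nbrs v :&: P & #|X| = m.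
  by apply: exists_subset_card; apply: leq_trans vP; rewrite leq_pmulr.
have [Q' sQ' cQ'] : exists2 X : {set G}, X \subset Q & #|X| = m.-1.
  apply: exists_subset_card; apply: (leq_trans (leq_pred _)).
  rewrite -(leq_pmul2l a0); apply: leq_trans hQ.
  by rewrite (leq_trans _ (leq_addl _ _)) // leq_pmulr.
have sP'N : P' \subset nbrs v := subset_trans sP' (subsetIl _ _).
have sP'P : P' \subset P := subset_trans sP' (subsetIr _ _).
have dPQ := complete_between_disjoint PQ.
have vPQ : v \notin P :|: Q by rewrite (disjointFr dV).
have vQ' : v \notin Q'.
  by apply: contra vPQ => /(subsetP sQ') vQ; rewrite inE vQ orbT.
have -> : P :|: Q :|: V = (P' :|: (v |: Q')) :|: ((P :\: P') :|: (Q :\: Q') :|: (V :\ v)).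
  apply/setP=> u; rewrite !inE.
  case: (boolP (u \in P')) => [/(subsetP sP'P) ->|_] //=.
  case: (eqVneq u v) => [->|_] /=; first by rewrite vV !orbT.
  case: (boolP (u \in Q')) => [/(subsetP sQ') ->|_] //=; by rewrite orbT.
apply: tiled_byU.
- rewrite disjoints_subset; apply/subsetP=> u; rewrite !inE => /or3P[uP|/eqP->|uQ].
  + have uPP := subsetP sP'P _ uP.
    rewrite uP /= (disjointFr dPQ) // andbF /= (disjointFl dV) ?andbF //.
    by rewrite inE uPP.
  + by move: vPQ; rewrite inE negb_or eqxx => /andP[/negbTE-> /negbTE->]; rewrite !andbF.
  + have uQQ := subsetP sQ' _ uQ.
    rewrite uQ /= (disjointFl dPQ) // andbF /= (disjointFl dV) ?andbF //.
    by rewrite inE uQQ orbT.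
- apply: balanced => //; last by rewrite cardsU1 vQ' cQ' add1n prednK.
  move=> u w uP'; rewrite !inE => /predU1P[->|wQ].
    by have := subsetP sP'N _ uP'; rewrite inE adj_sym.
  by apply: PQ; [exact: (subsetP sP'P)|exact: (subsetP sQ')].
have cPd : #|P :\: P'| = #|P| - m by rewrite cardsDS // cP'.
have cQd : #|Q :\: Q'| = #|Q| - m.-1 by rewrite cardsDS // cQ'.
have leP : m <= #|P| by rewrite -cP' subset_leq_card.
have leQ : m.-1 <= #|Q| by rewrite -cQ' subset_leq_card.
apply: IHk.
- by move: cV; rewrite (cardsD1 v) vV add1n => -[].
- exact: complete_betweenS (subsetDl _ _) (subsetDl _ _) PQ.
- apply: disjointWl (subsetDl _ _) (disjointWr _ dV).
  by rewrite setUSS // subsetDl.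
- move=> w; rewrite in_setD1 => /andP[_ wV].
  have drop (X Y : {set G}) : #|Y| <= m -> m * k.+1 <= #|nbrs w :&: X| ->
      m * k <= #|nbrs w :&: (X :\: Y)|.
    move=> cY cX; rewrite setIDA -(leq_add2r m) -mulnSr; apply: leq_trans cX _.
    rewrite -(cardsID Y (_ :&: X)) addnC leq_add2l; apply: leq_trans cY.
    by rewrite subset_leq_card // subsetIr.
  case: (nV w wV) => [wP|wQ]; [left|right]; apply: drop => //; first by rewrite cP'.
  by rewrite cQ' leq_pred.
- have : a * m <= a * #|P| by rewrite leq_mul2l leP orbT.
  rewrite cPd cQd !mulnBr; move: hP; rewrite mulnSr.
  move: (a * #|P|) (b * #|Q|) (b * m.-1) (a * m * k) (a * m) C; clear; lia.
- have : a * m <= a * #|Q|.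
    by apply: leq_trans hQ; rewrite (leq_trans _ (leq_addl _ _)) // leq_pmulr.
  have : a * m.-1 <= a * m by rewrite leq_mul2l leq_pred orbT.
  rewrite cPd cQd !mulnBr; move: hQ; rewrite mulnSr.
  move: (a * #|Q|) (b * #|P|) (b * m) (a * m.-1) (a * m * k) (a * m) C; clear; lia.
Qed.

End Absorb.

(** The tiles are taken slightly less unbalanced than the most unbalanced subdivision
    allows, by the summand [1] in [B]: this gives a tile of scale [t] a slack of at
    least [t], which pays for the vertices it absorbs. *)
Lemma perfect_tiling_hcf1 (H : sgraph) (X : {set H}) g :
  0 < #|edges H| -> hcf_xi H = Some 1 -> side_weight (~: X) < side_weight X -> 0 < g ->
  exists n0, forall G : sgraph, n0 <= #|G| ->
    dense_graph (side_weight X) (side_weight (~: X)) g G -> perfect_subdivision_tiling H G.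
Proof.
set a := side_weight X; set b := side_weight (~: X) => eH hcf1 ba g0.
have b0 : 0 < b := side_weight_gt0 _ eH.
have a0 : 0 < a := ltn_trans b0 ba.
have [C interior] := bip_tileable_interior eH hcf1 ba.
rewrite -/a -/b in interior.
pose m := a + b.
have m0 : 0 < m by rewrite addn_gt0 a0.
have balanced : bip_tileable H m m by exact: (@bip_tileable_balanced H eH X m (leqnn _)).
pose A := a * (2 * g); pose B := b * (2 * g) + 1; pose S := A + B.
have B0 : 0 < B by rewrite /B addn1.
have BA : B < A.
  have : (b + 1) * (2 * g) <= a * (2 * g) by rewrite leq_mul2r addn1 ba orbT.
  by rewrite /A /B mulnDl mul1n; move: g0 (b * _) (a * _); clear; lia.
have S0 : 0 < S by rewrite /S addn_gt0 B0 orbT.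
have g20 : 0 < 2 * g by rewrite muln_gt0.
(* A tile absorbs up to [q] vertices, each with [2 * (m * q)] neighbours in it;
   its scale [t] provides the slack that this requires.  The factor [8 * S] makes
   the tiles with fewer neighbours of a vertex negligible in its degree.  Up to a
   constant factor [t] is [q], so that [e], the quality of the cover, does not
   depend on [q]. *)
pose k := 8 * S * a; pose q := C.+1; pose t := C + k * m * q; pose e := 4 * (S * S * (1 + k * m)).
have k0 : 0 < k by rewrite !muln_gt0 S0 a0.
have t0 : 0 < t by rewrite /t addn_gt0 !muln_gt0 ?S0 ?a0 ?m0 ?orbT.
have e0 : 0 < e by rewrite /e !muln_gt0 ?S0 ?addn_gt0.
have [n0 cover] := almost_cover B0 BA g20 e0 t0.
exists n0 => G nG dG.
have dG' : dense_graph A B (2 * g) G.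
  move=> u; have := dG u; set d := #|nbrs u|; rewrite -/(A + B) -/S.
  have s0 : 0 < a + b by [].
  rewrite -(leq_pmul2l (ltn0Sn 1)) => h; rewrite -(leq_pmul2l s0).
  apply: (@leq_trans (S * (2 * (#|G| * (b * g + (a + b)))))); last first.
    have -> : (a + b) * (2 * g * S * d) = S * (2 * (g * (a + b) * d)).
      by clear; lia.
    by rewrite leq_mul2l h orbT.
  have -> : (a + b) * (#|G| * (B * (2 * g) + S)) = #|G| * ((a + b) * (B * (2 * g) + S)).
    by rewrite mulnCA.
  have -> : S * (2 * (#|G| * (b * g + (a + b)))) = #|G| * (S * (2 * (b * g + (a + b)))).
    by clear; lia.
  rewrite leq_mul2l; apply/orP; right; rewrite /S /A /B.
  have -> : a * (2 * g) + (b * (2 * g) + 1) = 2 * g * (a + b) + 1 by clear; lia.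
  move: (a + b) s0 => s s0; have : g * s <= g * (s * s).
    by rewrite leq_mul2l leq_pmulr ?orbT.
  clear; nia.
have [W [[D [pD tD]] cW]] := cover G nG dG'.
apply/perfect_tilingP; pose L := ~: W.
pose R v := [set Z in D | 2 * (m * q) <= #|nbrs v :&: Z|].
have cardT Z : Z \in D -> t <= #|Z| <= S * t.
  move=> ZD; rewrite (tile_card B0 BA g20 e0 (tD Z ZD)) andbT.
  case: (tD Z ZD) => P [Q [PQ -> c]]; apply: (@leq_trans #|P|).
    by case: c => -[-> _] //; rewrite leq_pmull.
  by rewrite subset_leq_card // subsetUl.
have cD : #|D| * t <= #|G|.
  apply: (@leq_trans #|W|); last exact: max_card.
  rewrite -sum_nat_const.
  by rewrite (card_partition pD); apply: leq_sum => Z /cardT/andP[].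
have HR v : v \in L -> #|L| <= q * #|R v|.
  move=> _; have degW : #|nbrs v| <= #|L| + (#|R v| * (S * t) + #|D| * (2 * (m * q))).
    rewrite -(cardsID W) -(sum_card_capI _ pD) addnC leq_add //.
      by rewrite subset_leq_card // setDE subsetIr.
    rewrite -!sum_nat_const [X in _ <= X + _](eq_bigl (fun Z => (Z \in D) && (Z \in R v))).
      rewrite big_mkcondr -big_split /=; apply: leq_sum => Z ZD; rewrite in_set ZD /=.
      case: ifPn => [_|]; last by rewrite -ltnNge => /ltnW.
      apply: leq_trans _ (leq_addr _ _).
      case/andP: (cardT Z ZD) => _; apply: leq_trans.
      by rewrite subset_leq_card // subsetIr.
    by move=> Z; rewrite in_set andbA andbb.
  have nS : #|G| <= S * #|nbrs v|.
    rewrite -(leq_pmul2l g20) mulnA; apply: leq_trans (dG' v).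
    by rewrite mulnC leq_mul2l (leq_trans _ (leq_addr _ _)) ?orbT // leq_pmull.
  have tq : t <= q * (1 + k * m).
    by rewrite /t mulnDr muln1 (mulnC q) leq_add2r.
  have kt : k * m * q <= t by rewrite leq_addl.
  rewrite -(leq_pmul2l e0); apply: (leq_trans cW).
  apply: (@leq_trans (2 * (S * S * t) * #|R v|)); last first.
    have : S * S * t * #|R v| <= S * S * (q * (1 + k * m)) * #|R v|.
      by rewrite leq_mul2r leq_mul2l tq !orbT.
    rewrite /e; have -> : 4 * (S * S * (1 + k * m)) * (q * #|R v|) =
      4 * (S * S * (q * (1 + k * m)) * #|R v|) by clear; lia.
    rewrite -(mulnA 2).
    by move: (S * S * t * #|R v|) (S * S * (q * _) * #|R v|) => x y; clear; lia.
  have h1 : 4 * (S * #|L|) <= #|G|.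
    apply: leq_trans cW; apply: (@leq_trans (4 * (S * (S * (1 + k * m) * #|L|)))).
      by rewrite leq_mul2l leq_mul2l leq_pmull ?orbT // muln_gt0 S0.
    by apply: eq_leq; rewrite /e -/L !mulnA.
  have h2 : 4 * (S * (#|D| * (2 * (m * q)))) <= #|G|.
    apply: leq_trans cD; apply: (@leq_trans (#|D| * (k * m * q))); last by rewrite leq_mul2l kt orbT.
    have -> : 4 * (S * (#|D| * (2 * (m * q)))) = #|D| * (8 * S * m * q) by clear; lia.
    by rewrite leq_mul2l !leq_mul2r /k leq_pmulr ?orbT.
  have h3 : S * #|nbrs v| <= S * #|L| + (S * S * t * #|R v| + S * (#|D| * (2 * (m * q)))).
    rewrite (leq_trans (_ : _ <= S * (#|L| + (#|R v| * (S * t) + #|D| * (2 * (m * q)))))) //.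
      by rewrite leq_mul2l degW orbT.
    by rewrite !mulnDr; apply: eq_leq; clear; lia.
  rewrite -(mulnA 2); move: nS h1 h2 h3.
  move: (S * #|nbrs v|) (S * #|L|) (S * (#|D| * _)) (S * S * t * _) #|G|; clear; lia.
have [s [sR sq]] := greedy_assignment set0 HR.
pose F (Z : {set G}) := Z :|: [set v in L | s v == Z].
have -> : [set: G] = \bigcup_(Z in D) F Z.
  apply/eqP; rewrite eq_sym -subTset; apply/subsetP => v _; apply/bigcupP.
  have [vW|vW] := boolP (v \in W).
    case/and3P: pD => /eqP cDW _ _; move: vW; rewrite -cDW => /bigcupP[Z ZD vZ].
    by exists Z; rewrite // inE vZ.
  have vL : v \in L by rewrite in_setC.
  have := sR v vL; rewrite in_set => /andP[sD _].
  by exists (s v); rewrite // !inE vW eqxx orbT.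
have ZW Z : Z \in D -> Z \subset W.
  by case/and3P: pD => /eqP <- _ _ ZD; exact: bigcup_sup ZD.
have dZL Z : Z \in D -> [disjoint L & Z].
  by move=> /ZW sZ; rewrite disjoint_sym disjoints_subset setCK.
have subL Z : [set v in L | s v == Z] \subset L.
  by apply/subsetP => v; rewrite inE => /andP[].
apply: tiled_by_bigcup => [Z1 Z2 D1 D2 ne|Z ZD].
  apply: disjointUl; apply: disjointUr.
  - by case/and3P: pD => _ /trivIsetP tr _; exact: tr.
  - by rewrite disjoint_sym (disjointWl (subL _)) ?dZL.
  - by rewrite (disjointWl (subL _)) ?dZL.
  - rewrite -setI_eq0; apply/eqP/setP => v; rewrite !inE.
    by case: eqP => [->|]; rewrite ?andbF //= (negbTE ne) !andbF.
have [P [Q [PQ eZ c]]] := tD Z ZD; rewrite /F eZ.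
set V := [set v in L | _].
have cV : #|V| <= q by rewrite /V -eZ.
have slack : C + a * m * #|V| <= t.
  rewrite leq_add2l -mulnA (leq_trans (_ : _ <= a * (m * q))) //.
    by rewrite !leq_mul2l cV !orbT.
  by rewrite -mulnA leq_mul2r /k leq_pmull ?orbT // muln_gt0.
have dPQ := complete_between_disjoint PQ.
apply: (absorb_pair a0 m0 interior balanced (erefl _) PQ).
- by apply: disjointWl (subL _) _; rewrite -eZ dZL.
- move=> v; rewrite inE => /andP[vL /eqP sv].
  have := sR v vL; rewrite in_set => /andP[_]; rewrite sv setIUr => hv.
  have := leq_trans hv (leq_card_setU _ _).1.
  have : m * #|V| <= m * q by rewrite leq_mul2l cV orbT.
  case: (leqP (m * #|V|) #|nbrs v :&: P|) => [|h1 h2 h3]; [by left|right].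
  by move: h1 h2 h3; clear; lia.
- case: c => -[-> ->]; rewrite -addnA.
    apply: (@leq_trans (b * t + t)); first by rewrite leq_add2l.
    by rewrite addnC -mulSn leq_mul2r ba orbT.
  apply: (@leq_trans (b * (A * t) + a * t)); first by rewrite leq_add2l (leq_trans slack) // leq_pmull.
  by apply: eq_leq; rewrite /A /B; clear; lia.
- case: c => -[-> ->]; rewrite -addnA.
    apply: (@leq_trans (b * t + t)); first by rewrite leq_add2l.
    by rewrite addnC -mulSn leq_mul2r ba orbT.
  apply: (@leq_trans (b * (B * t) + t)); first by rewrite leq_add2l.
  apply: (@leq_trans (b.+1 * (A * t))).
    rewrite mulSn addnC leq_add //; first by rewrite leq_pmull // (leq_trans _ BA).
    by rewrite leq_mul2l leq_mul2r ltnW ?orbT.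
  by rewrite leq_mul2r ba orbT.
Qed.

(** * Spanning subdivisions from Hamiltonian paths *)

Section Hamilton.
Variable G : sgraph.
Implicit Types (x y u v : G) (w : seq G) (U : {set G}).

Fixpoint gaps w : nat :=
  if w is x :: w' then (if w' is y :: _ then (~~ adj x y : nat) else 0) + gaps w' else 0.

Lemma gaps_cat w1 x w2 : gaps (w1 ++ x :: w2) = gaps (rcons w1 x) + gaps (x :: w2).
Proof.
elim: w1 => [|y w1 IH]; first by [].
by rewrite cat_cons rcons_cons [LHS]/= [gaps (y :: rcons _ _)]/= IH addnA; case: w1 {IH}.
Qed.

Lemma gaps_rev w : gaps (rev w) = gaps w.
Proof.
elim: w => [//|x [|y w] IH //].
rewrite rev_cons [in LHS]rev_cons -cats1 cat_rcons gaps_cat -rev_cons IH.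
by rewrite /= adj_sym; lia.
Qed.

Definition consecutive w x y := exists w1 w2, w = w1 ++ x :: y :: w2.

Lemma gapsP w : 0 < gaps w -> exists x y, consecutive w x y /\ ~~ adj x y.
Proof.
elim: w => [|x [|y w] IH] //; have [xy|xy] := boolP (adj x y).
  rewrite [gaps _]/= xy add0n => /IH[x' [y' [[w1 [w2 ->]] nxy]]].
  by exists x', y'; split=> //; exists (x :: w1), w2.
by exists x, y; split=> //; exists [::], w.
Qed.

Lemma gaps0_path x w : gaps (x :: w) = 0 -> path (@adj G) x w.
Proof.
elim: w x => [|y w IH] x //=; case: (adj x y) => //= h.
by apply: IH.
Qed.

Lemma consecutive_zip x w y z : (y, z) \in zip (belast x w) w -> consecutive (x :: w) y z.
Proof.
elim: w x => [|x' w IH] x //=; rewrite inE => /predU1P[[-> ->]|/IH[w1 [w2 ->]]].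
  by exists [::], w.
by exists (x :: w1), w2.
Qed.

Lemma zip_consecutive x w y z : consecutive (x :: w) y z -> (y, z) \in zip (belast x w) w.
Proof.
case=> w1 [w2]; elim: w1 x w => [|x' w1 IH] x w /=; first by case=> -> ->; rewrite inE eqxx.
case=> _ ->; case: w1 IH => [|x1 w1] IH /=; rewrite inE; apply/orP; right.
  by rewrite inE eqxx.
exact: (IH x1 _ erefl).
Qed.

Lemma consecutive_split w1 u v w2 x y : consecutive (w1 ++ u :: v :: w2) x y ->
  [\/ (x = u /\ y = v), consecutive (rcons w1 u) x y | consecutive (v :: w2) x y].
Proof.
case=> X [Y]; elim: w1 X => [|a w1 IH] [|c X] //=.
- by case=> -> -> _; constructor 1.
- by case=> _ E; constructor 3; exists X, Y.
- case=> -> E; constructor 2; case: w1 E {IH} => [|b w1] /= [-> _].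
    by exists [::], [::].
  by exists [::], (rcons w1 u).
- case=> -> /IH[h|[X' [Y' ->]]|h]; [by constructor 1| |by constructor 3].
  by constructor 2; exists (c :: X'), Y'.
Qed.

Lemma gaps_flip w1 x c M M' d y w2 : c :: M = rcons M' d ->
  adj x d -> adj c y -> ~~ adj x c || ~~ adj d y ->
  gaps (w1 ++ x :: rev (c :: M) ++ y :: w2) < gaps (w1 ++ x :: (c :: M) ++ y :: w2).
Proof.
move=> E xd cy bad; rewrite !(gaps_cat w1) ltn_add2l.
have e1 : gaps (x :: (c :: M) ++ y :: w2) =
    ~~ adj x c + (gaps (c :: M) + (~~ adj d y + gaps (y :: w2))).
  have -> : gaps (x :: (c :: M) ++ y :: w2) = ~~ adj x c + gaps ((c :: M) ++ y :: w2) by [].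
  by rewrite E cat_rcons gaps_cat.
have e2 : gaps (x :: rev (c :: M) ++ y :: w2) =
    ~~ adj x d + (gaps (c :: M) + (~~ adj c y + gaps (y :: w2))).
  have -> : gaps (x :: rev (c :: M) ++ y :: w2) =
      ~~ adj x d + gaps (rev (c :: M) ++ y :: w2) by rewrite E rev_rcons.
  by congr (_ + _); rewrite rev_cons cat_rcons gaps_cat -rev_cons gaps_rev.
by rewrite e1 e2 xd cy; move: bad; case: (adj x c); case: (adj d y) => //= _; lia.
Qed.

(** Two vertices [u], [v] that are consecutive but not adjacent have, by the degree
    condition, another consecutive pair [x], [y] with [u], [x] adjacent and [v], [y]
    adjacent: reversing the part in between reduces the number of gaps and keeps
    both ends. *)
Lemma gaps_improve U s w : perm_eq w (enum U) -> ohead w = Some s ->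
  (forall u, u \in U -> #|U| < 2 * #|nbrs u :&: U|) -> 0 < gaps w ->
  exists w', [/\ perm_eq w' w, ohead w' = Some s, last s w' = last s w & gaps w' < gaps w].
Proof.
case: w => [|s' r] // pw [es]; subst s' => dU /gapsP[u [v [cuv nuv]]].
have mw x : (x \in s :: r) = (x \in U) by rewrite (perm_mem pw) mem_enum.
have [uw vw] : u \in s :: r /\ v \in s :: r.
  by case: cuv => X [Y ->]; rewrite !mem_cat !inE !eqxx !orbT.
have cnt x : count (adj x) (s :: r) = #|nbrs x :&: U|.
  rewrite (seq.permP pw) -size_filter cardE; apply/perm_size/uniq_perm.
  - by rewrite filter_uniq // enum_uniq.
  - exact: enum_uniq.
  - by move=> y; rewrite mem_filter !mem_enum !inE.
have sw : size (s :: r) = #|U| by rewrite (perm_size pw) -cardE.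
set L := zip (belast s r) r.
have sL : size (belast s r) = size r by rewrite size_belast.
have cu : #|nbrs u :&: U| <= (count (fun p => adj u p.1) L).+1.
  have -> : count (fun p => adj u p.1) L = count (adj u) (belast s r).
    by rewrite -(count_map fst (adj u)) -/(unzip1 L) unzip1_zip ?sL.
  by rewrite -cnt lastI -cats1 count_cat -addn1 leq_add2l /= addn0 leq_b1.
have cv : #|nbrs v :&: U| <= (count (fun p => adj v p.2) L).+1.
  have -> : count (fun p => adj v p.2) L = count (adj v) r.
    by rewrite -(count_map snd (adj v)) -/(unzip2 L) unzip2_zip ?sL.
  by rewrite -cnt /= -add1n leq_add2r leq_b1.
have uvL : (u, v) \in L by exact: zip_consecutive.
have cor : (count (predU (fun p => adj u p.1) (fun p => adj v p.2)) L).+1 <= size r.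
  have <- : size L = size r by rewrite size_zip sL minnn.
  rewrite -(count_predC (predU (fun p => adj u p.1) (fun p => adj v p.2)) L).
  rewrite -addn1 leq_add2l -has_count; apply/hasP; exists (u, v) => //=.
  by rewrite !adj_irrefl.
have hand : has (predI (fun p => adj u p.1) (fun p => adj v p.2)) L.
  rewrite has_count.
  have := count_predUI (fun p => adj u p.1) (fun p => adj v p.2) L.
  have := dU u; have := dU v; rewrite -!mw uw vw -sw /= => /(_ isT) d1 /(_ isT) d2.
  move: cor cu cv d1 d2; clear; lia.
case/hasP: hand => -[x y] /consecutive_zip cxy /= /andP[ux vy].
have keep X z M y' Z : s :: r = X ++ z :: M ++ y' :: Z ->
    let w' := X ++ z :: rev M ++ y' :: Z in
    [/\ perm_eq w' (s :: r), ohead w' = Some s & last s w' = last s (s :: r)].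
  move=> E w'; rewrite E /w'; split.
  - by rewrite perm_cat2l perm_cons perm_cat2r perm_rev.
  - by have : ohead (s :: r) = Some s; first by []; rewrite E; case: (X).
  - by rewrite !last_cat /= !last_cat.
case: cuv => X [Y E]; rewrite E in cxy.
case/consecutive_split: cxy => [[exu _]|[X' [Y' E']]|[X' [Y' E']]].
- by rewrite exu adj_irrefl in ux.
- have e2 : s :: r = X' ++ x :: (y :: Y') ++ v :: Y by rewrite E -cat_rcons E' -catA.
  have [M' [eM]] : exists M', y :: Y' = rcons M' u.
    have := congr1 (last s) E'; rewrite last_rcons last_cat /= => eu.
    by exists (belast y Y'); rewrite eu -lastI.
  have [k1 k2 k3] := keep _ _ _ _ _ e2.
  exists (X' ++ x :: rev (y :: Y') ++ v :: Y); split=> //.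
  rewrite -[X in _ < X]/(gaps (s :: r)) e2; apply: gaps_flip eM _ _ _; rewrite ?nuv ?orbT //.
    by rewrite adj_sym.
  by rewrite adj_sym.
- case: X' E' => [|v' X'] /= [ev E'].
    by rewrite -ev (negbTE nuv) in ux.
  subst v'; have e2 : s :: r = X ++ u :: (v :: rcons X' x) ++ y :: Y'.
    by rewrite E E' /= cat_rcons.
  have [k1 k2 k3] := keep _ _ _ _ _ e2.
  exists (X ++ u :: rev (v :: rcons X' x) ++ y :: Y'); split=> //.
  rewrite -[X in _ < X]/(gaps (s :: r)) e2.
  by apply: gaps_flip (erefl : v :: rcons X' x = rcons (v :: X') x) _ _ _; rewrite ?nuv.
Qed.

Lemma hamilton_connected U s t : s \in U -> t \in U -> s != t ->
  (forall u, u \in U -> #|U| < 2 * #|nbrs u :&: U|) ->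
  exists l, [/\ uniq l, l =i U :\: [set s; t] & path (@adj G) s (rcons l t)].
Proof.
move=> sU tU st dU.
have start : exists w, [/\ perm_eq w (enum U), ohead w = Some s & last s w = t].
  exists (s :: rcons (enum (U :\: [set s; t])) t); split=> //; last by rewrite /= last_rcons.
  apply: uniq_perm; rewrite ?enum_uniq //.
    rewrite /= mem_rcons inE negb_or st rcons_uniq enum_uniq !mem_enum !inE.
    by rewrite !eqxx orbT.
  move=> x; rewrite inE mem_rcons inE !mem_enum !inE.
  by case: (eqVneq x s) => [->|_] //=; case: (eqVneq x t) => [->|].
case: start => w []; elim: {w}(gaps w) {-2}w (leqnn (gaps w)) => [|n IHn] w gw pw hw lw.
  case: w gw pw hw lw => [|s' r] // gw pw [es] lw; subst s'.
  have : uniq (s :: r) by rewrite (perm_uniq pw) enum_uniq.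
  have mw x : (x \in s :: r) = (x \in U) by rewrite (perm_mem pw) mem_enum.
  have pth : path (@adj G) s r by apply: gaps0_path; apply/eqP; rewrite -leqn0.
  case/lastP: r lw mw pth {gw pw} => [|l t'] /=; first by move=> e; rewrite e eqxx in st.
  rewrite last_rcons => -> mw pth; rewrite mem_rcons inE rcons_uniq negb_or.
  case/and3P=> /andP[_ sl] tl ul; exists l; split=> // x.
  rewrite in_setD -mw !inE mem_rcons inE.
  case: (eqVneq x s) => [->|_] /=; first by rewrite (negbTE sl).
  by case: (eqVneq x t) => [->|_] //=; rewrite (negbTE tl).
have [g0|g0] := posnP (gaps w); first by apply: (IHn w); rewrite ?g0.
have [w' [pw' hw' lw' gw']] := gaps_improve pw hw dU g0.
apply: (IHn w') => //; first by rewrite -ltnS (leq_trans gw').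
  exact: perm_trans pw' pw.
by rewrite lw'.
Qed.

End Hamilton.

(** Every edge of [H] is subdivided once, through a common neighbour; then the first
    edge of one of the resulting paths is replaced by a Hamiltonian path of what is
    left. *)
Lemma perfect_tiling_half (H : sgraph) g : 0 < #|edges H| -> 0 < g ->
  exists n0, forall G : sgraph, n0 <= #|G| ->
    dense_graph 1 1 g G -> perfect_subdivision_tiling H G.
Proof.
move=> eH g0; pose h := #|H| + #|edges H|.
exists (g * h).+1 => G nG dG.
have h0 : 0 < h by rewrite addn_gt0 eH orbT.
have nh : h <= #|G| by apply: leq_trans nG; apply: leqW; rewrite leq_pmull.
have deg (u : G) : #|G| + 2 * h < 2 * #|nbrs u|.
  rewrite -(ltn_pmul2l g0); have := dG u; move: nG; rewrite -mulnA.
  move: (#|nbrs u|) #|G| => d n; clear; nia.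
have [B _ cB] : exists2 B : {set G}, B \subset setT & #|B| = #|H|.
  by apply: exists_subset_card; rewrite cardsT; apply: leq_trans nh; exact: leq_addr.
have [z0 _] : exists z, z \in [set: G].
  by apply/card_gt0P; rewrite cardsT; exact: leq_ltn_trans nG.
have [b [bI' bB]] := exists_bijection_on z0 (etrans (cardsT H) (esym cB)).
have bI : injective b by move=> x y; apply: bI'; rewrite inE.
pose R (e : {set H}) := [set z | [forall x in e, adj (b x) z]] :\: B.
have RE x y : [set z in nbrs (b x) :&: nbrs (b y)] :\: B \subset R [set x; y].
  apply/subsetP => z; rewrite !inE => /andP[-> /andP[xz yz]] /=.
  by apply/forall_inP => w; rewrite !inE => /orP[] /eqP ->.
have cR e : e \in edges H -> #|edges H| <= 1 * #|R e|.
  rewrite mul1n => /edgesP[x [y [_ ->]]].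
  apply: leq_trans (subset_leq_card (RE x y)); rewrite cardsD.
  have : #|[set z in nbrs (b x) :&: nbrs (b y)] :&: B| <= #|H|.
    by rewrite -cB subset_leq_card // subsetIr.
  have -> : [set z in nbrs (b x) :&: nbrs (b y)] = nbrs (b x) :&: nbrs (b y).
    by apply/setP=> z; rewrite inE.
  have := cardsUI (nbrs (b x)) (nbrs (b y)); have := max_card (mem (nbrs (b x) :|: nbrs (b y))).
  have := deg (b x); have := deg (b y); rewrite /h.
  move: #|_ :|: _| #|nbrs (b x)| #|nbrs (b y)| #|_ :&: nbrs (b y)| #|_ :&: B| #|G| #|H| #|edges H|.
  clear; lia.
have [s [sR s1]] := greedy_assignment z0 cR.
pose m (e : {set H}) := Some (s e).
pose W := B :|: [set s e | e in edges H].
have sRE e x : e \in edges H -> x \in e -> adj (b x) (s e).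
  by move=> eE xe; have := sR e eE; rewrite !inE => /andP[_ /forall_inP]; apply.
have sB e : e \in edges H -> s e \notin B.
  by move=> eE; have := sR e eE; rewrite inE => /andP[].
have dr : drawing b (fun x y => seq_of_opt (m [set x; y])) W.
  apply: drawing_of_midpoints => //.
  - move=> x y z xy [<-]; split; first by apply: sRE; rewrite ?edge_set2 // !inE eqxx.
    move=> w; apply: contraTneq (sB _ (edge_set2 xy)) => <-.
    by rewrite negbK -bB imset_f.
  - move=> e e' z eE e'E [<-] [E].
    have := s1 (s e); apply: contraTeq => ne; rewrite -ltnNge.
    apply: (@leq_trans #|[set e; e']|); first by rewrite cards2 ne.
    apply/subset_leq_card/subsetP=> e1; rewrite in_set2 => /orP[] /eqP->.
      by rewrite in_set eE eqxx.
    by rewrite in_set e'E E eqxx.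
  - move=> u; rewrite inE -bB; split.
      case/orP=> /imsetP[x xE ->]; first by left; exists x.
      by right; exists x.
    case=> [[x ->]|[e eE [<-]]]; first by rewrite imset_f.
    by rewrite (imset_f s eE) orbT.
case/card_gt0P: (eH) => _ /edgesP[x0 [y0 [xy0 _]]].
set z := s [set x0; y0].
have zR : adj (b x0) z by apply: sRE; rewrite ?edge_set2 // !inE eqxx.
have bz : b x0 != z by apply: contraTneq zR => <-; rewrite adj_irrefl.
have bW : b x0 \in W by rewrite inE -bB imset_f.
have zW : z \in W by rewrite inE (imset_f s (edge_set2 xy0)) orbT.
pose U := ~: W :|: [set b x0; z].
have [||||l [ul ml pl]] := @hamilton_connected G U (b x0) z.
- by rewrite !inE eqxx orbT.
- by rewrite !inE eqxx !orbT.
- exact: bz.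
- move=> u _; have cW : #|W| <= h.
    apply: leq_trans (leq_card_setU _ _).1 _; rewrite cB leq_add2l.
    exact: leq_imset_card.
  have : #|nbrs u| <= #|nbrs u :&: U| + #|W|.
    rewrite -(cardsID U) leq_add2l; apply/subset_leq_card/subsetP => v.
    by rewrite !inE negb_or negbK => /andP[/andP[]].
  have := deg u; have := max_card (mem U); move: #|U| #|W| cW #|_ :&: _| => cU cW.
  move: #|nbrs u| #|G|; clear; lia.
have nlW v : v \in l -> v \notin W.
  by rewrite ml !inE => /andP[/norP[/negbTE-> /negbTE->]]; rewrite !orbF.
have [p' dr'] : exists p', drawing b p' (W :|: [set v in l]).
  apply: drawing_insert dr xy0 _ ul _ => //.
  by rewrite disjoint_has; apply/hasPn => v /nlW.
apply/perfect_tilingP/tiled_by1; exists b, p'.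
suff -> : [set: G] = W :|: [set v in l] by [].
apply/setP=> v; rewrite !inE ml !inE.
have := bW; have := zW; rewrite !inE => hz hb.
case: (eqVneq v (b x0)) => [->|vb] /=; first by rewrite hb.
case: (eqVneq v z) => [->|vz] /=; first by rewrite hz.
by rewrite orbF orbN.
Qed.

(** * Obstructions to perfect tilings *)

(** The paths of a drawing are indexed by ordered pairs; counting vertices needs one
    orientation of each edge. *)
Lemma edge_orientation (H : sgraph) (x0 : H) : exists o : {set H} -> H * H,
  forall e, e \in edges H -> adj (o e).1 (o e).2 /\ e = [set (o e).1; (o e).2].
Proof.
pose P (e : {set H}) (xy : H * H) := adj xy.1 xy.2 && (e == [set xy.1; xy.2]).
exists (fun e => odflt (x0, x0) [pick xy | P e xy]) => e /edgesP[x [y [xy ex]]].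
case: pickP => [[x' y'] /andP[? /eqP]|/(_ (x, y))] //=.
by rewrite /P /= xy ex eqxx.
Qed.

Lemma drawing_card (H G : sgraph) (b : H -> G) p W (o : {set H} -> H * H) (c : {set G}) :
  drawing b p W ->
  (forall e, e \in edges H -> adj (o e).1 (o e).2 /\ e = [set (o e).1; (o e).2]) ->
  #|W :&: c| = #|[set x | b x \in c]| +
    \sum_(e in edges H) count (mem c) (p (o e).1 (o e).2).
Proof.
move=> [bI Hp Hb Hd HW] Ho; pose F e := [set u in p (o e).1 (o e).2 | u \in c].
have -> : W :&: c = (b @: [set x | b x \in c]) :|: \bigcup_(e in edges H) F e.
  apply/setP=> u; rewrite in_setI in_setU; apply/andP/orP.
    case=> /HW[[x ->]|[x [y [xy up]]]] uc.
      by left; apply: imset_f; rewrite inE.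
    right; apply/bigcupP; exists [set x; y]; first exact: edge_set2.
    have [oa oe] := Ho _ (edge_set2 xy); rewrite inE uc andbT.
    have [_ _ rv] := Hp _ _ xy.
    case: (o [set x; y]) oa oe => x' y' /= oa oe.
    have : x \in [set x'; y'] by rewrite -oe !inE eqxx.
    have : y \in [set x'; y'] by rewrite -oe !inE eqxx orbT.
    rewrite !inE => /orP[] /eqP ey /orP[] /eqP ex; subst x y => //.
    - by rewrite adj_irrefl in xy.
    - by rewrite rv mem_rev.
    - by rewrite adj_irrefl in xy.
  case=> [/imsetP[x]|/bigcupP[e eE]].
    by rewrite inE => xc ->; split=> //; apply/HW; left; exists x.
  rewrite inE => /andP[up uc]; split=> //; apply/HW; right.
  by exists (o e).1, (o e).2; case: (Ho e eE).
rewrite cardsU_disjoint; last first.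
  apply/bigcup_disjointP => e eE; rewrite -setI_eq0; apply/eqP/setP => u; rewrite !inE.
  apply/andP => -[/imsetP[x _ ->] /andP[bp _]].
  by have [oa _] := Ho e eE; rewrite (negbTE (Hb _ _ x oa)) in bp.
rewrite card_imset // card_bigcup_disjoint.
  congr (_ + _); apply: eq_bigr => e eE; have [oa _] := Ho e eE.
  have [_ un _] := Hp _ _ oa; move: un; rewrite /= rcons_uniq => /andP[_ /andP[_ un]].
  rewrite -size_filter /F; have := card_uniqP (filter_uniq (mem c) un) => <-.
  by apply: eq_card => u; rewrite !inE mem_filter andbC.
move=> e e' eE e'E ne; have [oa oe] := Ho e eE; have [oa' oe'] := Ho e' e'E.
have := Hd _ _ _ _ oa oa'; rewrite -oe -oe' => /(_ ne) d.
rewrite -setI_eq0; apply/eqP/setP => u; rewrite !inE.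
by apply/andP => -[/andP[u1 _] /andP[u2 _]]; rewrite (disjointFr d u1) in u2.
Qed.

Lemma path_independent_count (G : sgraph) (c : {set G}) x l y :
  (forall u v, adj u v -> ~~ ((u \in c) && (v \in c))) ->
  path (@adj G) x (rcons l y) ->
  count (mem c) l + (x \in c) + (y \in c) <= (count (mem (~: c)) l).+1.
Proof.
move=> ind; elim: l x => [|z l IH] x /= /andP[xz].
  by move=> _; have := ind _ _ xz; case: (x \in c); case: (y \in c).
move=> /IH; have := ind _ _ xz; rewrite in_setC.
by case: (x \in c); case: (z \in c); case: (y \in c) => //= _; lia.
Qed.

Lemma path_bipartite_count (G : sgraph) (c : {set G}) x l y :
  (forall u v, adj u v -> (u \in c) != (v \in c)) ->
  path (@adj G) x (rcons l y) ->
  count (mem c) l + (x \in c) + (y \in c) = (count (mem (~: c)) l).+1.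
Proof.
move=> bip; elim: l x => [|z l IH] x /= /andP[xz].
  by move=> _; have := bip _ _ xz; case: (x \in c); case: (y \in c).
move=> /IH; have := bip _ _ xz; rewrite in_setC.
by case: (x \in c); case: (z \in c); case: (y \in c) => //= _; lia.
Qed.

(** No two consecutive vertices of a path are in [c], so each path has at least as
    many internal vertices outside [c] as the most economical one with the same
    ends, and at most as many more inside as it has more outside. *)
Lemma drawn_independent (H G : sgraph) (c W : {set G}) :
  0 < #|edges H| -> (forall u v, adj u v -> ~~ ((u \in c) && (v \in c))) ->
  @drawn_on H G W -> exists X d,
    [/\ #|W :\: c| = side_weight (~: X) + d, #|W :&: c| <= @side_weight H X + d &
        (forall u v, adj u v -> (u \in c) != (v \in c)) ->
          #|W :&: c| = side_weight X + d].
Proof.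
move=> eH ind [b [p dr]].
have [x0 _] : exists x0 : H, True.
  by case/card_gt0P: eH => e /edgesP[x _]; exists x.
have [o Ho] := edge_orientation x0.
pose X := [set x | b x \in c].
pose i e := count (mem c) (p (o e).1 (o e).2).
pose j e := count (mem (~: c)) (p (o e).1 (o e).2).
have Wc : #|W :&: c| = #|X| + \sum_(e in edges H) i e := drawing_card c dr Ho.
have Wnc : #|W :\: c| = #|~: X| + \sum_(e in edges H) j e.
  rewrite setDE (drawing_card (~: c) dr Ho); congr (#|pred_of_set _| + _).
  by apply/setP=> x; rewrite !inE.
have cardE (Y : {set H}) : #|induced_edges Y| = \sum_(e in edges H) (e \in induced_edges Y).
  rewrite -sum1_card [in RHS]big_mkcond [in LHS]big_mkcond; apply: eq_bigr => e _.
  by rewrite [e \in induced_edges Y]inE; case: (e \in edges H); case: (e \subset Y).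
have inX e : e \in edges H -> (e \in induced_edges X) = (b (o e).1 \in c) && (b (o e).2 \in c).
  move=> eE; have [oa {1}->] := Ho e eE; rewrite induced_edgesP //.
  by rewrite [_.1 \in X]inE [_.2 \in X]inE.
have inY e : e \in edges H ->
    (e \in induced_edges (~: X)) = (b (o e).1 \notin c) && (b (o e).2 \notin c).
  move=> eE; have [oa {1}->] := Ho e eE; rewrite induced_edgesP //.
  by rewrite [_.1 \in ~: X]inE [_.2 \in ~: X]inE [_.1 \in X]inE [_.2 \in X]inE.
have pth e : e \in edges H -> path (@adj G) (b (o e).1) (rcons (p (o e).1 (o e).2) (b (o e).2)).
  by move=> eE; have [oa _] := Ho e eE; case: dr => _ Hp _ _ _; case: (Hp _ _ oa).
have le_j e : e \in edges H -> (e \in induced_edges X) <= j e.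
  move=> eE; have := path_independent_count ind (pth e eE); rewrite inX // -/(i e) -/(j e).
  by case: (_ \in c); case: (_ \in c) => //=; lia.
exists X, (\sum_(e in edges H) (j e - (e \in induced_edges X))).
have sumj : \sum_(e in edges H) j e = #|induced_edges X| +
    \sum_(e in edges H) (j e - (e \in induced_edges X)).
  by rewrite cardE -big_split; apply: eq_bigr => e eE; rewrite /= subnKC // le_j.
split.
- by rewrite Wnc sumj /side_weight setCK addnA.
- rewrite Wc /side_weight -addnA leq_add2l cardE -big_split; apply: leq_sum => e eE /=.
  have := path_independent_count ind (pth e eE); have := le_j e eE.
  rewrite inX // inY // -/(i e) -/(j e).
  by case: (_ \in c); case: (_ \in c) => //=; lia.
- move=> bip; rewrite Wc /side_weight -addnA cardE -big_split; congr (_ + _).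
  apply: eq_bigr => e eE /=; have := path_bipartite_count bip (pth e eE).
  have := le_j e eE; rewrite inX // inY // -/(i e) -/(j e).
  by case: (_ \in c); case: (_ \in c) => //=; lia.
Qed.

(** In the join of a clique on [k] vertices with an independent set, every tile has at
    least [b / a] times as many vertices in the clique as in the independent set. *)
Lemma forces_tiling_space (H : sgraph) (X0 : {set H}) n k :
  0 < #|edges H| -> side_weight (~: X0) <= side_weight X0 ->
  (forall X : {set H}, side_weight (~: X0) * side_weight X <= side_weight (~: X) * side_weight X0) ->
  forces_tiling n H k ->
  side_weight (~: X0) * n <= (side_weight X0 + side_weight (~: X0)) * k.
Proof.
set a := side_weight X0; set b := side_weight (~: X0) => eH ba minX force.
have [nk|kn] := leqP n k.
  by apply: (@leq_trans (b * k)); rewrite ?leq_mul2l ?leq_mul2r ?nk ?leq_addl ?orbT.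
pose e (i j : 'I_n) := (i != j) && ((i < k) || (j < k)).
have eS : symmetric e by move=> i j; rewrite /e eq_sym orbC.
have eI : irreflexive e by move=> i; rewrite /e eqxx.
pose G := SGraph eS eI.
have deg : min_degree_ge G k.
  move=> i; rewrite /degree /adj /= /e; have [ik|ki] := ltnP i k.
    apply: (@leq_trans n.-1); first by rewrite -ltnS (ltn_predK kn).
    rewrite -[n in n.-1]card_ord -(cardC1 i) cardsE; apply: eq_leq; apply: eq_card => j.
    by rewrite !unfold_in /= andbT eq_sym.
  rewrite -{1}(card_ord_lt (ltnW kn)); apply/subset_leq_card/subsetP => j; rewrite !inE => jk.
  by rewrite jk orbT andbT; apply: contraTneq jk => <-; rewrite -leqNgt.
have /perfect_tilingP tG := force G (card_ord n) deg.
pose c : {set G} := [set i : 'I_n | k <= i].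
have ind (u v : G) : adj u v -> ~~ ((u \in c) && (v \in c)).
  by rewrite /adj /= /e !inE => /andP[_]; case: ltnP; case: ltnP.
have : b * #|[set: G] :&: c| <= a * #|[set: G] :\: c|.
  move: tG; apply: (@tiled_by_ind _ _ (fun W => b * #|W :&: c| <= a * #|W :\: c|)).
    by rewrite set0I set0D cards0 !muln0.
  move=> W W' drW dWW' _ IH.
  have [X [d [eo ei _]]] := drawn_independent eH ind drW.
  have dI : [disjoint W :&: c & W' :&: c].
    by apply: disjointWl (subsetIl _ _) (disjointWr (subsetIl _ _) dWW').
  have dD : [disjoint W :\: c & W' :\: c].
    by apply: disjointWl (subsetDl _ _) (disjointWr (subsetDl _ _) dWW').
  rewrite setIUl setDUl !cardsU_disjoint // !mulnDr leq_add // eo.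
  apply: (@leq_trans (b * (side_weight X + d))); first by rewrite leq_mul2l ei orbT.
  rewrite !(mulnDr _ _ d); apply: leq_add; first by rewrite (mulnC a) minX.
  by rewrite leq_mul2r ba orbT.
have cc : #|~: c| = k.
  rewrite -[RHS](card_ord_lt (ltnW kn)); apply: eq_card => i; by rewrite !inE -ltnNge.
have cn : #|c| + k = n by rewrite -[RHS]card_ord -(cardsC c) cc.
rewrite setTI setTD cc mulnDl -{1}cn mulnDr leq_add2r //.
Qed.

Lemma big_gcdn_dvd (l : seq int) c : c \in l -> \big[gcdn/0]_(z <- l) `|z|%N %| `|c|%N.
Proof.
elim: l => // z l IH; rewrite inE big_cons => /predU1P[->|/IH]; first exact: dvdn_gcdl.
by apply: dvdn_trans; exact: dvdn_gcdr.
Qed.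

(** In a complete bipartite graph the difference between the sides is a sum of elements
    of [C_xi H], one for each tile; the sides are chosen with difference 1 or 2. *)
Lemma forces_tiling_divisibility (H : sgraph) n k :
  0 < #|edges H| -> \big[gcdn/0]_(z <- C_xi H) `|z|%N != 1 ->
  \big[gcdn/0]_(z <- C_xi H) `|z|%N != 2 -> forces_tiling n H k -> n <= 2 * k.+1.
Proof.
set h := \big[gcdn/0]_(z <- _) _ => eH h1 h2 force; rewrite leqNgt; apply/negP => kn.
pose s := n.-1./2.
have [sn sk] : s <= n /\ k <= s by rewrite /s; lia.
have ns : n - s - s = 1 \/ n - s - s = 2 by rewrite /s; lia.
pose e (i j : 'I_n) := (i < s) != (j < s).
have eS : symmetric e by move=> i j; rewrite /e eq_sym.
have eI : irreflexive e by move=> i; rewrite /e eqxx.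
pose G := SGraph eS eI.
pose c : {set G} := [set i : 'I_n | i < s].
have cc : #|c| = s := card_ord_lt sn.
have cC : #|~: c| = n - s by apply/eqP; rewrite -(eqn_add2l #|c|) cardsC card_ord cc subnKC.
have deg : min_degree_ge G k.
  move=> i; rewrite /degree /adj /= /e; apply: (leq_trans sk); case: (ltnP i s) => is_.
    apply: (@leq_trans #|~: c|); first by rewrite cC; lia.
    by apply/subset_leq_card/subsetP => j; rewrite !inE.
  rewrite -{1}cc; apply/subset_leq_card/subsetP => j; rewrite !inE => ->.
  by [].
have /perfect_tilingP tG := force G (card_ord n) deg.
have bip (u v : G) : adj u v -> (u \in c) != (v \in c) by rewrite /adj /= /e !inE.
have ind (u v : G) : adj u v -> ~~ ((u \in c) && (v \in c)).
  by move/bip; case: (u \in c); case: (v \in c).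
have : (h%:Z %| (#|[set: G] :&: c|%:Z - #|[set: G] :\: c|%:Z)%R)%Z.
  move: tG; apply: (@tiled_by_ind _ _ (fun W => (h%:Z %| (#|W :&: c|%:Z - #|W :\: c|%:Z)%R)%Z)).
    by rewrite set0I set0D cards0.
  move=> W W' drW dWW' _ IH.
  have [X [d [eo _ /(_ bip) ei]]] := drawn_independent eH ind drW.
  have dI : [disjoint W :&: c & W' :&: c].
    by apply: disjointWl (subsetIl _ _) (disjointWr (subsetIl _ _) dWW').
  have dD : [disjoint W :\: c & W' :\: c].
    by apply: disjointWl (subsetDl _ _) (disjointWr (subsetDl _ _) dWW').
  rewrite setIUl setDUl !cardsU_disjoint //.
  have -> (x y z t : nat) : ((x + y)%N%:Z - (z + t)%N%:Z = (x%:Z - z%:Z) + (y%:Z - t%:Z))%R by lia.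
  rewrite GRing.rpredD // eo ei.
  have -> (x y : nat) : ((x + d)%N%:Z - (y + d)%N%:Z = x%:Z - y%:Z)%R by lia.
  rewrite dvdzE absz_nat; apply: big_gcdn_dvd; apply/mapP; exists X; first by rewrite mem_enum.
  by rewrite /side_weight setCK.
rewrite setTI setTD cc cC dvdzE absz_nat.
have -> : `|(s%:Z - (n - s)%N%:Z)%R|%N = n - s - s by lia.
case: ns => ->; first by rewrite dvdn1 (negbTE h1).
move=> h2' ; have := dvdn_leq (isT : 0 < 2) h2'.
by move: h1 h2 h2'; case: (h) => [|[|[|h']]].
Qed.

(** * The threshold *)

Local Open Scope ring_scope.
Import Order.TTheory GRing.Theory Num.Theory.

Lemma forces_tiling_delta_sub (n : nat) (H : sgraph) : forces_tiling n H (delta_sub n H).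
Proof. by rewrite /delta_sub; case: ex_minnP => k /asboolP. Qed.

Lemma delta_sub_le (n : nat) (H : sgraph) k : forces_tiling n H k -> (delta_sub n H <= k)%N.
Proof. by move=> fk; rewrite /delta_sub; case: ex_minnP => m _; apply; apply/asboolP. Qed.

Lemma f_HE (H : sgraph) (X : {set H}) :
  f_H X = (side_weight X + side_weight (~: X))%N%:R / (side_weight X)%:R.
Proof.
rewrite /f_H /side_weight setCK; congr (_%:R / _); rewrite -(cardsC X); lia.
Qed.

Lemma xi_min (H : sgraph) : (0 < #|edges H|)%N -> exists X0 : {set H},
  xi H = f_H X0 /\ forall X : {set H},
    (side_weight (~: X0) * side_weight X <= side_weight (~: X) * side_weight X0)%N.
Proof.
move=> eH; have [X0 eX0] : exists X0 : {set H}, xi H = f_H X0.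
  rewrite /xi; apply: (big_ind (fun x => exists X, x = @f_H H X)) => [|x y [X ->] [Y ->]|X _].
  - by exists set0.
    by rewrite /Order.min; case: ifP => _; [exists X|exists Y].
  by exists X.
exists X0; split=> // X.
have : xi H <= f_H X by exact: bigmin_le.
have pos (Y : {set H}) : 0 < (side_weight Y)%:R :> rat by rewrite ltr0n side_weight_gt0.
have split_ratio (x y : nat) : 0 < x%:R :> rat -> (x + y)%N%:R / x%:R = 1 + y%:R / x%:R :> rat.
  by move=> x0; rewrite natrD mulrDl divff ?lt0r_neq0.
rewrite eX0 !f_HE !split_ratio // lerD2l.
by rewrite ler_pdivrMr // mulrAC ler_pdivlMr // -!natrM ler_nat.
Qed.

Lemma big_gcdn_hcf (H : sgraph) h : hcf_xi H <> Some h.+1 ->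
  \big[gcdn/0%N]_(z <- C_xi H) `|z|%N != h.+1.
Proof.
rewrite /hcf_xi; case: ifP => [all0 _|_]; last by move/eqP; apply: contra => /eqP->.
suff -> : \big[gcdn/0%N]_(z <- C_xi H) `|z|%N = 0%N by [].
by apply: big1_seq => z /andP[_ /(allP all0) /eqP ->].
Qed.

Lemma delta_sub_upper_bound (R : realType) (H : sgraph) (a b : nat) (gamma : R) :
  (0 < a)%N -> 0 < gamma ->
  (forall g, (0 < g)%N -> exists n0, forall G : sgraph, (n0 <= #|G|)%N ->
     dense_graph a b g G -> perfect_subdivision_tiling H G) ->
  exists n0 : nat, forall n, (n0 <= n)%N ->
    (delta_sub n H)%:R <= (b%:R / (a + b)%N%:R + gamma) * n%:R.
Proof.
move=> a0 gamma0 tile.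
(* Half of [gamma] is the margin in [dense_graph], the other half pays for rounding
   the degree bound down to the integer [k]. *)
pose g := (Num.trunc (2 / gamma)).+1.
have gg : 2 < gamma * g%:R.
  by rewrite mulrC -ltr_pdivrMr // truncnS_gt.
have [n0 Hn0] := tile g isT; exists (n0 + g)%N => n len.
have s0 : 0 < (a + b)%N%:R :> R by rewrite ltr0n addn_gt0 a0.
set beta := b%:R / _; have beta0 : 0 <= beta by rewrite divr_ge0.
have y0 : 0 <= (beta + gamma) * n%:R by rewrite mulr_ge0 // addr_ge0 // ltW.
set k := Num.trunc ((beta + gamma) * n%:R).
have /andP[k1 k2] := truncn_itv y0; apply: le_trans k1; rewrite ler_nat.
apply: delta_sub_le => G cG dG; apply: Hn0; first by rewrite cG (leq_trans _ len) ?leq_addr.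
move=> u; have := dG u; rewrite cG -/(nbrs u) /degree -/(nbrs u) => ku.
rewrite -(ler_nat R) !natrM !natrD !natrM.
have ku' : (beta + gamma) * n%:R - 1 <= #|nbrs u|%:R.
  rewrite lerBlDr natr1 ltW // (lt_le_trans k2) // ler_nat ltnS; exact: ku.
have ng : g%:R <= n%:R :> R by rewrite ler_nat (leq_trans _ len) // leq_addl.
have g0 : 0 < g%:R :> R by rewrite ltr0n.
have {1}-> : b%:R = beta * (a%:R + b%:R) by rewrite /beta natrD divfK // -natrD lt0r_neq0.
rewrite natrD in s0; move: s0; set s : R := a%:R + b%:R => s0.
apply: (@le_trans _ _ (g%:R * s * ((beta + gamma) * n%:R - 1))); last first.
  by rewrite ler_wpM2l // mulr_ge0 // ltW.
have -> : n%:R * (beta * s * g%:R + s) = s * (n%:R * (beta * g%:R + 1)) by ring.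
rewrite (mulrC g%:R) -[leRHS]mulrA ler_wpM2l ?(ltW s0) //.
have : 0 <= (gamma * g%:R - 2) * n%:R by rewrite mulr_ge0 // subr_ge0 ltW.
by move: (n%:R : R) (g%:R : R) ng gg => N K; nra.
Qed.

Lemma ratr_ratio (R : realType) (a b : nat) : (0 < a)%N ->
  1 - (ratr ((a + b)%N%:R / a%:R : rat) : R)^-1 = b%:R / (a + b)%N%:R.
Proof.
move=> a0; rewrite fmorph_div /= !ratr_nat invf_div.
have s0 : (a + b)%N%:R != 0 :> R by rewrite pnatr_eq0 addn_eq0 negb_and -lt0n a0.
by rewrite -{1}(divff s0) -mulrBl natrD addrC addKr.
Qed.

Theorem theorem1p8 (R : realType) (H : sgraph)
    (H_edge : (0 < #|edges H|)%N) (H_hcf : hcf_xi H <> Some 2%N)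
    (gamma : R) (gamma_gt0 : 0 < gamma) :
  exists n0 : nat, forall n : nat, (n0 <= n)%N ->
    (1 - (ratr (xi_star H) : R)^-1) * n%:R - 1 <= (delta_sub n H)%:R :> R /\
    (delta_sub n H)%:R <= (1 - (ratr (xi_star H) : R)^-1 + gamma) * n%:R :> R.
Proof.
have [hcf1|hcf1] := pselect (hcf_xi H = Some 1%N).
  have [X0 [eX0 minX]] := xi_min H_edge.
  set a := side_weight X0 in minX; set b := side_weight (~: X0) in minX.
  have a0 : (0 < a)%N := side_weight_gt0 _ H_edge.
  have b0 : (0 < b)%N := side_weight_gt0 _ H_edge.
  (* If [a <= b], minimality makes all differences in [C_xi H] vanish. *)
  have ba : (b < a)%N.
    rewrite ltnNge; apply/negP => ab; move: hcf1; rewrite /hcf_xi.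
    have le_side (X : {set H}) : (side_weight X <= side_weight (~: X))%N.
      rewrite -(leq_pmul2r a0); apply: (leq_trans _ (minX X)).
      by rewrite mulnC leq_mul2r ab orbT.
    case: ifP => // /negP[]; apply/allP => c /mapP[X _ ->] /=.
    have := le_side X; have := le_side (~: X); rewrite setCK /side_weight setCK.
    move=> h1 h2; rewrite subr_eq0; apply/eqP; congr Posz.
    by apply/eqP; rewrite eqn_leq h1 h2.
  have -> : xi_star H = (a + b)%N%:R / a%:R by rewrite /xi_star hcf1 eX0 f_HE.
  rewrite ratr_ratio //.
  have [n0 Hn0] : exists n0 : nat, forall n, (n0 <= n)%N ->
      (delta_sub n H)%:R <= (b%:R / (a + b)%N%:R + gamma) * n%:R.
    by apply: delta_sub_upper_bound => // g; exact: perfect_tiling_hcf1.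
  exists n0 => n /Hn0 ub; split=> //.
  have := forces_tiling_space H_edge (ltnW ba) minX (@forces_tiling_delta_sub n H).
  rewrite -/a -/b -(ler_nat R) !natrM => lb.
  have s0 : 0 < (a + b)%N%:R :> R by rewrite ltr0n addn_gt0 a0.
  rewrite lerBlDr mulrAC ler_pdivrMr // mulrDl mul1r (mulrC _%:R (a + b)%N%:R).
  by rewrite (le_trans lb) // lerDl ltW.
have -> : xi_star H = (1 + 1)%N%:R / 1%:R.
  rewrite /xi_star divr1; move: H_hcf hcf1; case: (hcf_xi H) => // -[|[|[|h]]] //.
rewrite ratr_ratio //.
have [n0 Hn0] : exists n0 : nat, forall n, (n0 <= n)%N ->
    (delta_sub n H)%:R <= (1%:R / (1 + 1)%N%:R + gamma) * n%:R.
  by apply: delta_sub_upper_bound => // g; exact: perfect_tiling_half.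
exists n0 => n /Hn0 ub; split=> //.
have := forces_tiling_divisibility H_edge (big_gcdn_hcf hcf1) (big_gcdn_hcf H_hcf)
  (@forces_tiling_delta_sub n H).
rewrite -(ler_nat R) natrM -(natr1 (delta_sub n H)) => lb.
rewrite -[(1 + 1)%N]/2%N; move: lb.
by move: (n%:R : R) ((delta_sub n H)%:R : R) => x y; lra.
Qed.
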